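(* Let $\{\hat P_n\}_{n=0}^\infty$ be the orthonormal system of exceptional Jacobi polynomials generated by one Darboux transformation from the Jacobi polynomials with parameters $\alpha,\beta$, of arbitrary codimension, orthonormal on $(-1,1)$ with respect to $W=\frac{(1-x)^{\alpha+\varepsilon_1}(1+x)^{\beta+\varepsilon_2}}{\tilde b^2}$. If $\alpha+\varepsilon_1\ge -\frac12$ and $\beta+\varepsilon_2\ge-\frac12$, then the measures $$d\mu_n(x)=\frac1n\sum_{k=0}^{n-1}\hat P_k^2(x)W(x)\,dx \quad\text{on } [-1,1]$$ converge in the weak-star sense, as $n\to\infty$, to the equilibrium measure $\mu_e$ of $[-1,1]$, i.e. to $d\mu_e(x)=\frac{dx}{\pi\sqrt{1-x^2}}$.
   Context: Exceptional Jacobi setup (one Darboux transformation). Let $\alpha,\beta>-1$, $w^{(\gamma,\delta)}(x)=(1-x)^\gamma(1+x)^\delta$, $p(x)=1-x^2$, $q(x)=\beta-\alpha-(\alpha+\beta+2)x$, and $T[y]=py''+qy'$. $P_n^{(\gamma,\delta)}$ denotes the Jacobi polynomial defined by Rodrigues' formula $(1-x)^{\gamma}(1+x)^{\delta}P_n^{(\gamma,\delta)}(x)=\frac{(-1)^n}{2^nn!}\left((1-x)^{\gamma+n}(1+x)^{\delta+n}\right)^{(n)}$, and $p_n=P_n^{(\alpha,\beta)}/\varrho_n$ ($\varrho_n>0$) are the orthonormal Jacobi polynomials with respect to $w^{(\alpha,\beta)}$ on $(-1,1)$. Let $\phi$ be one of the following quasi-rational eigenfunctions of $T$, $N\ge 0$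 an integer: (i) $(1-x)^{-\alpha}P_N^{(-\alpha,\beta)}(x)$; (ii) $(1+x)^{-\beta}P_N^{(\alpha,-\beta)}(x)$; (iii) $(1-x)^{-\alpha}(1+x)^{-\beta}P_N^{(-\alpha,-\beta)}(x)$. Let $\tilde\lambda$ be its eigenvalue, $T\phi=\tilde\lambda\phi$, and let $w=\phi'/\phi$ (a rational function satisfying $p(w'+w^2)+qw=\tilde\lambda$). Let, up to a nonzero constant factor, $b_0$ be respectively $(1-x)P_N^{(-\alpha,\beta)}(x)$, $(1+x)P_N^{(\alpha,-\beta)}(x)$, $(1-x^2)P_N^{(-\alpha,-\beta)}(x)$, and let $b=s\,b_0$, where $s$ is a real polynomial with no zeros on $[-1,1]$. Then $b$ and $bw$ are polynomials. It is assumed that $b$ has no zeros in $(-1,1)$ and that $$b(x)=(1-x)^{\frac{1-\varepsilon_1}{2}}(1+x)^{\frac{1-\varepsilon_2}{2}}\tilde b(x),\qquad \varepsilon_1,\varepsilon_2\in\{-1,1\},$$ with $\tilde b$ a polynomial, $\tilde b>0$ on $[-1,1]$. The exceptional Jacobi polynomials are $P_n^{[1]}=b\,p_n'-bw\,p_n$, $n=0,1,2,\dots$, and the weight is $W=\frac{p\,w^{(\alpha,\beta)}}{b^2}=\frac{w^{(\alpha+\varepsilon_1,\beta+\varepsilon_2)}}{\tilde b^2}$. Standing assumptions: $\{P_n^{[1]}\}_{n\ge0}$ is a complete orthogonal system in $L^2_W(-1,1)$; $P_n^{[1]}(\pm1)\ne0$ for all $n$; and if $b(a)=0$ for $a\in\{-1,1\}$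 then $(bw)(a)\neq0$. The codimension of the system is $\deg\tilde b$. Finally $\sigma_n=\|P_n^{[1]}\|_{W,2}=\left(\int_{-1}^1 (P_n^{[1]})^2W\right)^{1/2}$ and $\hat P_n=P_n^{[1]}/\sigma_n$. *)

(* Defs.v *)
From HB Require Import structures.
From mathcomp Require Import all_boot all_order all_algebra.
From mathcomp Require Import all_classical all_reals all_analysis.
From mathcomp Require Import measurable_realfun.
From mathcomp Require Import ring lra.
Set Implicit Arguments.
Unset Strict Implicit.
Unset Printing Implicit Defensive.
Import Order.TTheory GRing.Theory Num.Theory.
Import numFieldNormedType.Exports.
Local Open Scope classical_set_scope.
Local Open Scope ring_scope.

Section jacobi.
Context {R : realType}.
Implicit Types (c d x : R) (n : nat) (P : {poly R}).

Definition jacobi_weight c d x : R := (1 - x) `^ c * (1 + x) `^ d.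

Definition rodrigues c d n P : Prop :=
  forall x, x \in `]-1, 1[ ->
    jacobi_weight c d x * P.[x] =
    (-1) ^+ n / (2 ^+ n * n`!%:R) *
      derive1n n (jacobi_weight (c + n%:R) (d + n%:R)) x.

(* The parameters are arbitrary reals; [jacobi_rodrigues] below shows that the
   default value of [xget] is never taken. *)
Definition jacobi c d n : {poly R} := xget 0 [set P | rodrigues c d n P].

Lemma jacobi_weight_ge0 c d x : 0 <= jacobi_weight c d x.
Proof. by rewrite mulr_ge0// powR_ge0. Qed.

Lemma is_derive_jacobi_weight c d x : x \in `]-1, 1[ ->
  is_derive x 1 (jacobi_weight c d)
    (jacobi_weight (c - 1) (d - 1) x * (d * (1 - x) - c * (1 + x))).
Proof.
rewrite in_itv/= => /andP[x1 x2].
have x1' : 0 < 1 - x by lra.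
have x2' : 0 < 1 + x by lra.
have d1 : is_derive x 1 (fun t : R => 1 - t) (-1).
  by have := is_deriveB (is_derive_cst (1 : R) x 1) (is_derive_id x 1);
    rewrite sub0r.
have d2 : is_derive x 1 (fun t : R => 1 + t) 1.
  by have := is_deriveD (is_derive_cst (1 : R) x 1) (is_derive_id x 1);
    rewrite add0r.
have D1 := @is_derive1_comp _ (fun y : R => y `^ c) (fun t : R => 1 - t) _ _ _
  (@is_derive1_powR _ c _ x1') d1.
have D2 := @is_derive1_comp _ (fun y : R => y `^ d) (fun t : R => 1 + t) _ _ _
  (@is_derive1_powR _ d _ x2') d2.
have := is_deriveM D1 D2.
move=> /is_derive_eq; apply; rewrite /jacobi_weight /= /GRing.scale/=.
have e (a s : R) : 0 < a -> a `^ s = a `^ (s - 1) * a.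
  move=> a0; rewrite -[X in _ = _ * X](powRr1 (ltW a0)) -powRD.
    by rewrite subrK.
  by rewrite (gt_eqF a0) implybT.
rewrite (e _ c x1') (e _ d x2').
ring.
Qed.

Lemma derive1n_jacobi_weight c d n : exists P, forall x, x \in `]-1, 1[ ->
  derive1n n (jacobi_weight c d) x =
  jacobi_weight (c - n%:R) (d - n%:R) x * P.[x].
Proof.
elim: n => [|n [P ih]].
  by exists 1 => x _; rewrite derive1n0 !subr0 hornerE mulr1.
pose q := (d - n%:R) *: (1 - 'X) - (c - n%:R) *: (1 + 'X) : {poly R}.
exists (q * P + (1 - 'X) * (1 + 'X) * P^`()) => x x01.
rewrite derive1nS derive1E.
have near_x : \near x, derive1n n (jacobi_weight c d) x =
    (jacobi_weight (c - n%:R) (d - n%:R) * horner P) x.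
  have : \near x, x \in `]-1, 1[ by exact: near_in_itvoo.
  by apply: filterS => y /ih.
rewrite (near_eq_derive _ near_x).
have D1 := is_derive_jacobi_weight (c - n%:R) (d - n%:R) x01.
have D2 : is_derive x 1 (horner P) (P^`()).[x] by exact: is_derive_poly.
have -> := @derive_val _ _ _ _ _ _ _ (is_deriveM D1 D2).
move: x01; rewrite in_itv/= => /andP[x1 x2].
have x1' : 0 < 1 - x by lra.
have x2' : 0 < 1 + x by lra.
have e (a s : R) : 0 < a -> a `^ s = a `^ (s - 1) * a.
  move=> a0; rewrite -[X in _ = _ * X](powRr1 (ltW a0)) -powRD.
    by rewrite subrK.
  by rewrite (gt_eqF a0) implybT.
have -> : (q * P + (1 - 'X) * (1 + 'X) * P^`()).[x] =
    ((d - n%:R) * (1 - x) - (c - n%:R) * (1 + x)) * P.[x] +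
    (1 - x) * (1 + x) * P^`().[x].
  by rewrite /q !hornerE.
rewrite -natr1 !opprD !addrA /jacobi_weight /GRing.scale/=.
rewrite (e _ (c - n%:R) x1') (e _ (d - n%:R) x2').
ring.
Qed.

Lemma jacobi_rodrigues c d n : rodrigues c d n (jacobi c d n).
Proof.
rewrite /jacobi; apply: xgetPex.
have [P hP] := derive1n_jacobi_weight (c + n%:R) (d + n%:R) n.
exists (((-1) ^+ n / (2 ^+ n * n`!%:R)) *: P) => x x01.
by rewrite hP// !addrK hornerZ mulrCA.
Qed.

Definition jacobi_norm a b n : R :=
  Num.sqrt (\int[lebesgue_measure]_(x in `]-1, 1[)
    ((jacobi a b n).[x] ^+ 2 * jacobi_weight a b x)).

Definition ortho_jacobi a b n : {poly R} := (jacobi_norm a b n)^-1 *: jacobi a b n.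

End jacobi.

(* [seed_right], [seed_left], [seed_both]: the power prefactor sits at 1, at -1,
   or at both endpoints. *)
Variant seed := seed_right | seed_left | seed_both.

Section seeds.
Context {R : realType}.
Variables (alpha beta : R) (k : seed) (N : nat).

Definition seed_poly : {poly R} :=
  match k with
  | seed_right => jacobi (- alpha) beta N
  | seed_left => jacobi alpha (- beta) N
  | seed_both => jacobi (- alpha) (- beta) N
  end.

Definition seed_fun (x : R) : R :=
  match k with
  | seed_right => (1 - x) `^ (- alpha)
  | seed_left => (1 + x) `^ (- beta)
  | seed_both => (1 - x) `^ (- alpha) * (1 + x) `^ (- beta)
  end * seed_poly.[x].

Definition seed_log_derivative (x : R) : R := derive1 seed_fun x / seed_fun x.

Definition seed_b0 : {poly R} :=
  match k with
  | seed_right => 1 - 'X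
  | seed_left => 1 + 'X
  | seed_both => 1 - 'X^2
  end * seed_poly.

End seeds.

Section exceptional.
Context {R : realType}.
Variables (alpha beta : R) (b bw : {poly R}).

Definition xjacobi n : {poly R} :=
  b * (ortho_jacobi alpha beta n)^`() - bw * ortho_jacobi alpha beta n.

(* The signs epsilon_i in {-1, 1} are coded by booleans e_i through
   epsilon_i = (-1) ^+ e_i, so that (1 - epsilon_i) / 2 = e_i. *)
Variables (e1 e2 : bool) (bt : {poly R}).

(* When b = (1 - 'X) ^+ e1 * (1 + 'X) ^+ e2 * bt, this is
   (1 - x ^+ 2) * jacobi_weight alpha beta x / b.[x] ^+ 2 on (-1, 1). *)
Definition xweight (x : R) : R :=
  jacobi_weight (alpha + (-1) ^+ e1) (beta + (-1) ^+ e2) x / bt.[x] ^+ 2.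

Definition xnorm n : R :=
  Num.sqrt (\int[lebesgue_measure]_(x in `]-1, 1[)
    ((xjacobi n).[x] ^+ 2 * xweight x)).

Definition ortho_xjacobi n : {poly R} := (xnorm n)^-1 *: xjacobi n.

Definition xjacobi_density n (x : R) : R :=
  n%:R^-1 * (\sum_(k < n) (ortho_xjacobi k).[x] ^+ 2 * xweight x).

Lemma xweight_ge0 x : 0 <= xweight x.
Proof. by rewrite divr_ge0 ?sqr_ge0 ?jacobi_weight_ge0. Qed.

Lemma measurable_jacobi_weight (c d : R) :
  measurable_fun setT (jacobi_weight c d).
Proof.
apply: measurable_funM.
- apply: (measurableT_comp (measurable_powR c)) => //.
  exact: measurable_funB.
- apply: (measurableT_comp (measurable_powR d)) => //.
  exact: measurable_funD.
Qed.

Lemma measurable_xweight : measurable_fun setT xweight.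
Proof.
apply: measurable_funM; first exact: measurable_jacobi_weight.
rewrite (_ : (fun x => _) = fun x => (bt.[x] ^+ 2) `^ (-1)).
  apply: (measurableT_comp (measurable_powR (-1))) => //.
  by apply: measurable_funX; exact: measurable_poly.
by apply/funext => x; rewrite powR_inv1// sqr_ge0.
Qed.

Lemma xjacobi_density_ge0 n x : `[-1, 1]%classic x -> 0 <= xjacobi_density n x.
Proof.
move=> _; rewrite mulr_ge0 ?invr_ge0// sumr_ge0// => k _.
by rewrite mulr_ge0 ?sqr_ge0 ?xweight_ge0.
Qed.

Lemma measurable_xjacobi_density n :
  measurable_fun (`[-1, 1]%classic : set R) (xjacobi_density n).
Proof.
apply/measurable_funTS/measurable_funM => //.
apply: measurable_sum => k; apply: measurable_funM.
  by apply: measurable_funX; exact: measurable_poly.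
exact: measurable_xweight.
Qed.

End exceptional.

Section equilibrium.
Context {R : realType}.

Definition equilibrium_density (x : R) : R := (pi * Num.sqrt (1 - x ^+ 2))^-1.

Lemma equilibrium_density_ge0 x : `[-1, 1]%classic x -> 0 <= equilibrium_density x.
Proof. by move=> _; rewrite invr_ge0 mulr_ge0 ?sqrtr_ge0 ?pi_ge0. Qed.

Lemma measurable_equilibrium_density :
  measurable_fun (`[-1, 1]%classic : set R) equilibrium_density.
Proof.
apply: (eq_measurable_fun
    (fun x : R => pi^-1 * ((1 - x ^+ 2) `^ 2^-1) `^ (-1))).
  move=> x; rewrite inE/= in_itv/= => /andP[x1 x2].
  have x0 : 0 <= 1 - x ^+ 2 by nra.
  by rewrite /equilibrium_density powR_inv1 ?powR_ge0// powR12_sqrt// invfM.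
apply: measurable_funTS; apply: measurable_funM => //.
apply: (measurableT_comp (measurable_powR (-1))) => //.
apply: (measurableT_comp (measurable_powR 2^-1)) => //.
by apply: measurable_funB => //; exact: measurable_funX.
Qed.

End equilibrium.

Section density_measure.
Context {R : realType}.
Local Notation mu := (@lebesgue_measure R).
Variables (D : set R) (g : R -> R).
Hypotheses (mD : measurable D) (g0 : forall x, D x -> 0 <= g x)
  (mg : measurable_fun D g).

(* The measure g(x)dx on D, seen as a Borel measure on the line. *)
Definition density_measure
    (_ : measurable D) (_ : forall x, D x -> 0 <= g x)
    (_ : measurable_fun D g) : set (measurableTypeR R) -> \bar R :=
  fun A => (\int[mu]_(x in A `&` D) (g x)%:E)%E.

Local Notation nu := (density_measure mD g0 mg).

Let nu0 : nu set0 = 0%E.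
Proof. by rewrite /density_measure set0I integral_set0. Qed.

Let nu_ge0 A : (0 <= nu A)%E.
Proof. by apply: integral_ge0 => x [_ Dx]; rewrite lee_fin g0. Qed.

Let nu_sigma_additive : semi_sigma_additive nu.
Proof.
move=> /= F mF tF mUF; rewrite /density_measure; apply: cvg_toP.
  apply: ereal_nondecreasing_is_cvgn => m n mn.
  apply: lee_sum_nneg_natr => // k _ _; exact: nu_ge0.
rewrite setI_bigcupl ge0_integral_bigcup//=.
- by move=> k; exact: measurableI.
- apply/measurable_EFinP; apply: (measurable_funS mD) => //.
  by move=> x [k _ []].
- by move=> x [k _ [_ Dx]]; rewrite lee_fin g0.
- exact: trivIset_setIr.
Qed.

HB.instance Definition _ := isMeasure.Build _ _ _ nu nu0 nu_ge0 nu_sigma_additive.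

End density_measure.

Section measures.
Context {R : realType}.

Definition xjacobi_measure (alpha beta : R) (b bw : {poly R}) (e1 e2 : bool)
    (bt : {poly R}) (n : nat) : {measure set (measurableTypeR R) -> \bar R} :=
  density_measure (measurable_itv `[-1, 1])
    (@xjacobi_density_ge0 R alpha beta b bw e1 e2 bt n)
    (@measurable_xjacobi_density R alpha beta b bw e1 e2 bt n).

Definition equilibrium_measure : {measure set (measurableTypeR R) -> \bar R} :=
  density_measure (measurable_itv `[-1, 1])
    (@equilibrium_density_ge0 R) (@measurable_equilibrium_density R).

(* Weak-star convergence in the dual of C([-1, 1]). *)
Definition weak_star_cvg
    (nu : nat -> {measure set (measurableTypeR R) -> \bar R})
    (nu_lim : {measure set (measurableTypeR R) -> \bar R}) : Prop :=
  forall f : R -> R, {within `[-1, 1], continuous f} ->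
    (\int[nu n]_(x in `[-1, 1]) f x) @[n --> \oo] -->
    \int[nu_lim]_(x in `[-1, 1]) f x.

End measures.

Section weighted_L2.
Context {R : realType}.
Local Notation mu := (@lebesgue_measure R).
Local Notation I := (`]-1, 1[%classic : set R).
Variable w : R -> R.

Definition in_L2 (f : R -> R) : Prop :=
  measurable_fun I f /\
  mu.-integrable I (fun x => (f x ^+ 2 * w x)%:E).

Definition orthogonal_system (u : nat -> R -> R) : Prop :=
  (forall n, in_L2 (u n)) /\
  (forall m n, m != n -> \int[mu]_(x in I) (u m x * u n x * w x) = 0).

(* The finite linear combinations of the [u k] are dense in L^2_w(-1, 1). *)
Definition complete_system (u : nat -> R -> R) : Prop :=
  forall f, in_L2 f -> forall eps : R, 0 < eps ->
    exists m (c : nat -> R),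
      (\int[mu]_(x in I)
         ((f x - \sum_(k < m) c k * u k x) ^+ 2 * w x)%:E < eps%:E)%E.

End weighted_L2.

(* Main.v *)
Require Import Defs.
From mathcomp Require Import all_boot all_order all_algebra.
From mathcomp Require Import all_classical all_reals all_analysis.
From mathcomp Require Import measurable_realfun.
From mathcomp Require Import ring lra.
Set Implicit Arguments.
Unset Strict Implicit.
Unset Printing Implicit Defensive.
Import Order.TTheory GRing.Theory Num.Theory.
Import numFieldNormedType.Exports.
Local Open Scope classical_set_scope.
Local Open Scope ring_scope.

(** Let y be the Jacobi polynomial of degree n for the weight w on (-1, 1), p =
    1 - x^2, q the drift with (p w)' = q w, and E = n (n + alpha + beta + 1),
    so that p y'' + q y' = - E y. Up to normalisation, the density of the n-th
    exceptional polynomial is p w (y' - (bw / b) y)^2. Integration by parts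
    shows that the term y' alone has mass E times the mass of y, whereas the
    term (bw / b) y turns out to have mass o(E). The exceptional density is
    therefore asymptotic to that of y', and y' is an eigenpolynomial for the
    parameters alpha + 1, beta + 1: the question becomes one about classical
    Jacobi polynomials, and each single density converges, not only the Cesaro
    means.

    The classical case is a virial identity ([virial], [eigen_cvg]). If p z'' +
    q z' = lam z then, for every polynomial g, the integral of (p g' - x g) z^2
    w is 1 / (4 lam) times that of V z^2 w, with V a polynomial which depends
    on g but not on z. In the limit the probability measures z^2 w dx kill all
    the polynomials p g' - x g. As p g' - x g is sqrt p (sqrt p g)', the
    arcsine law kills them too, and together with the constants they span all
    polynomials ([cvg_equilibrium_functional]).

    The difficulty is the mass of (bw / b) y. It is at most a constant times
    the mass of y, hence negligible, except near an endpoint where b vanishes,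
    say 1, where (bw / b)^2 p w may grow like (1 - x)^(alpha - 1). Hardy's
    inequality bounds the integral of y^2 (1 - x)^(alpha - 1) by those of y^2 w
    and y'^2 p w, but the latter has the order E of the main term. Inserting
    the factor ((1 + x) / 2)^M ([hardy]) costs only a multiple of the mass of
    y, and leaves the main density tested against ((1 + x) / 2)^(M + 1).
    Divided by E, this tends to the arcsine mean of that function as n goes to
    infinity, and this mean is small for large M ([cvg_hardy]). Hardy's
    inequality needs alpha > 0; where b vanishes the exponent of the
    exceptional weight is alpha - 1, and the assumption that it is at least -
    1/2 gives alpha >= 1/2.

    It remains to pass from polynomials to continuous functions
    ([weierstrass_approximation]) and from single densities to their Cesaro
    means. *)

(** * Improper integrals on (-1, 1) *)

Section improper_FTC.
Context {R : realType}.
Local Notation mu := (@lebesgue_measure R).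
Variables (f F : R -> R) (u : nat -> R).
Hypotheses (u_nd : nondecreasing_seq u) (u01 : forall n, 0 < u n < 1)
  (u1 : u n @[n --> \oo] --> (1 : R)).
Hypotheses (fc : {in `]-1, 1[, continuous f})
  (Ff : forall x : R, x \in `]-1, 1[ -> is_derive x 1 F (f x)).

Let itv_u n (x : R) : x \in `[- u n, u n] -> x \in `]-1, 1[.
Proof.
rewrite !in_itv/= => /andP[x1 x2]; have /andP[u0 uu] := u01 n.
by apply/andP; split; lra.
Qed.

Let FTC_u n :
  (\int[mu]_(x in `[(- u n)%R, u n]) (f x)%:E = (F (u n) - F (- u n))%R%:E)%E.
Proof.
have /andP[u0 uu] := u01 n.
have Fc x : x \in `[- u n, u n] -> {for x, continuous F}.
  move=> /itv_u /Ff dF; apply/differentiable_continuous/derivable1_diffP.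
  exact: ex_derive.
rewrite EFinB; apply: continuous_FTC2; first lra.
- apply: continuous_in_subspaceT => x; rewrite inE => /itv_u.
  exact: fc.
- split.
  + by move=> x /subset_itv_oo_cc /itv_u /Ff dF; exact: ex_derive.
  + by apply: cvg_at_right_filter; apply: Fc; rewrite in_itv/=; apply/andP; split; lra.
  + by apply: cvg_at_left_filter; apply: Fc; rewrite in_itv/=; apply/andP; split; lra.
- move=> x /subset_itv_oo_cc /itv_u /Ff dF; rewrite derive1E.
  exact: derive_val.
Qed.

Let bigcup_u : \bigcup_n `[- u n, u n]%classic = `]-1, 1[%classic.
Proof.
apply/seteqP; split => [x [n _ xn]|x /=]; first exact: (itv_u xn).
rewrite in_itv/= => /andP[x1 x2].
have /cvgrPdist_lt /(_ (1 - `|x|)) := u1.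
rewrite subr_gt0 ltr_norml x1 x2 => /(_ isT) [n _ /(_ n)/=].
rewrite leqnn => /(_ isT); have /andP[u0 uu] := u01 n.
rewrite ger0_norm; last lra.
move=> xu; have : `|x| <= u n by lra.
by rewrite ler_norml => xn; exists n => //=; rewrite in_itv.
Qed.

Let set_nd : nondecreasing_seq (fun n => (`[- u n, u n]%classic : set R)).
Proof.
move=> m n mn; rewrite subsetEset => x /=; rewrite !in_itv/= => /andP[x1 x2].
by have := u_nd mn => umn; apply/andP; split; lra.
Qed.

Let mf : measurable_fun (`]-1, 1[%classic : set R) f.
Proof. by apply: open_continuous_measurable_fun => // x /[!inE]; exact: fc. Qed.

(** Monotone convergence gives the value of the integral, hence also the
    integrability of f; this is how singular powers are shown integrable. *)
Lemma ge0_improper_FTC (l : R) : (forall x : R, x \in `]-1, 1[ -> 0 <= f x) ->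
  F (u n) - F (- u n) @[n --> \oo] --> l ->
  (\int[mu]_(x in `](-1)%R, 1%R[) (f x)%:E = l%:E)%E.
Proof.
move=> f0 Fl.
have : (\int[mu]_(x in `[(- u n)%R, u n]) (f x)%:E)%E @[n --> \oo] -->
    (\int[mu]_(x in \bigcup_n `[(- u n)%R, u n]%classic) (f x)%:E)%E.
  apply: ge0_nondecreasing_set_cvg_integral => //.
  - move=> n; apply/measurable_EFinP; apply: measurable_funS mf => //.
    by move=> x; exact: itv_u.
  - by move=> n x /itv_u ?; rewrite lee_fin f0.
rewrite bigcup_u => /cvg_lim <-//; apply/cvg_lim => //.
under eq_fun do rewrite FTC_u.
by apply: cvg_EFin => //; exact: nearW.
Qed.

Lemma improper_FTC (l : R) : mu.-integrable `]-1, 1[ (EFin \o f) ->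
  F (u n) - F (- u n) @[n --> \oo] --> l ->
  \int[mu]_(x in `]-1, 1[) f x = l.
Proof.
move=> fi Fl.
pose g n := (EFin \o f) \_ (`[- u n, u n]%classic : set R).
have : (\int[mu]_(x in `](-1)%R, 1%R[) g n x)%E @[n --> \oo] -->
    (\int[mu]_(x in `](-1)%R, 1%R[) (f x)%:E)%E.
  apply: (@dominated_cvg _ _ _ mu _ _ _ _ (fun x => `|(f x)%:E|%E)) => //.
  - move=> n; apply/measurable_restrict => //; apply/measurable_EFinP.
    by apply: measurable_funS mf => // x [].
  - move=> x xI.
    have [m _ xm] : (\bigcup_n (`[- u n, u n]%classic : set R)) x by rewrite bigcup_u.
    apply: cvg_near_cst; exists m => // n mn.
    rewrite /g patchE ifT// inE; have := set_nd mn.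
    by rewrite subsetEset; apply.
  - exact: integrable_abse.
  - move=> n x _; rewrite /g patchE; case: ifP => // _.
    by rewrite abse0.
have gE n : (\int[mu]_(x in `](-1)%R, 1%R[) g n x = (F (u n) - F (- u n))%R%:E)%E.
  rewrite -FTC_u /g -integral_mkcondr setIidr//.
  by move=> x; exact: itv_u.
under eq_fun do rewrite gE.
move=> /cvg_lim; rewrite /Rintegral => <- //.
rewrite (_ : lim _ = l%:E)//; apply/cvg_lim => //.
by apply: cvg_EFin => //; exact: nearW.
Qed.

End improper_FTC.

(** * Jacobi weights *)

Section powers.
Context {R : realType}.
Local Notation mu := (@lebesgue_measure R).
Implicit Types (a b c x : R).

Let u n : R := 1 - n.+2%:R^-1.

Let u_nd : nondecreasing_seq u.
Proof.
by move=> m n mn; rewrite /u lerD2l lerN2 lef_pV2 ?posrE// ler_nat.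
Qed.

Let u01 n : 0 < u n < 1.
Proof.
rewrite /u subr_gt0 invf_lt1// ltr1n/= gtrBl invr_gt0 ltr0n//.
Qed.

Let Vn0 : (n.+2%:R^-1 : R) @[n --> \oo] --> (0 : R).
Proof. by have := @cvg_harmonic R; rewrite -cvg_shiftS. Qed.

Let u1 : u n @[n --> \oo] --> (1 : R).
Proof. by rewrite -[X in _ --> X]subr0; apply: cvgB; [exact: cvg_cst|]. Qed.

Let u2 : 1 + u n @[n --> \oo] --> (2 : R).
Proof.
by rewrite (_ : 2 = 1 + 1 :> R)//; apply: cvgD; [exact: cvg_cst|].
Qed.

Let powR_cvg0_seq c (v : nat -> R) : 0 < c -> (forall n, 0 < v n) ->
  v n @[n --> \oo] --> (0 : R) -> v n `^ c @[n --> \oo] --> (0 : R).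
Proof.
move=> c0 v0 v_cvg.
by have /cvg_at_rightP := powR_cvg0 c0; apply.
Qed.

Let powR_cvg_seq c (v : nat -> R) x : 0 < x ->
  v n @[n --> \oo] --> x -> v n `^ c @[n --> \oo] --> x `^ c.
Proof.
move=> x0 vx; apply: (cvg_comp v (fun y : R => y `^ c) vx).
have : {for x, continuous (fun y : R => y `^ c)}; last by [].
apply/differentiable_continuous/derivable1_diffP.
have := @is_derive1_powR _ c _ x0 => ?; exact: ex_derive.
Qed.

Lemma is_derive_onem_powR c x : x < 1 ->
  is_derive x 1 (fun t : R => (1 - t) `^ c) (- (c * (1 - x) `^ (c - 1))).
Proof.
move=> x1.
have d1 : is_derive x 1 (fun t : R => 1 - t) (-1).
  by have := is_deriveB (is_derive_cst (1 : R) x 1) (is_derive_id x 1);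
    rewrite sub0r.
have x0 : 0 < 1 - x by lra.
have := @is_derive1_comp _ (fun y : R => y `^ c) (fun t : R => 1 - t) _ _ _
  (@is_derive1_powR _ c _ x0) d1.
by move=> /is_derive_eq; apply; rewrite /GRing.scale/= mulrN1.
Qed.

Lemma is_derive_onep_powR c x : -1 < x ->
  is_derive x 1 (fun t : R => (1 + t) `^ c) (c * (1 + x) `^ (c - 1)).
Proof.
move=> x1.
have d1 : is_derive x 1 (fun t : R => 1 + t) 1.
  by have := is_deriveD (is_derive_cst (1 : R) x 1) (is_derive_id x 1);
    rewrite add0r.
have x0 : 0 < 1 + x by lra.
have := @is_derive1_comp _ (fun y : R => y `^ c) (fun t : R => 1 + t) _ _ _
  (@is_derive1_powR _ c _ x0) d1.
by move=> /is_derive_eq; apply; rewrite /GRing.scale/= mulr1.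
Qed.

Lemma integrable_onem_powR c : -1 < c ->
  mu.-integrable `]-1, 1[ (EFin \o (fun x : R => (1 - x) `^ c)).
Proof.
move=> c1; have c0 : 0 < c + 1 by lra.
apply/integrableP; split.
  apply/measurable_EFinP/measurable_funTS.
  apply: (measurableT_comp (measurable_powR c)) => //.
  exact: measurable_funB.
under eq_integral do rewrite /= ger0_norm ?powR_ge0//.
rewrite (@ge0_improper_FTC _ _ (fun x => - (c + 1)^-1 * (1 - x) `^ (c + 1)) u
  u_nd u01 u1 _ _ ((c + 1)^-1 * 2 `^ (c + 1))) ?ltry//.
- move=> x; rewrite in_itv/= => /andP[_ x1].
  apply/differentiable_continuous/derivable1_diffP.
  have := is_derive_onem_powR c x1 => ?; exact: ex_derive.
- move=> x; rewrite in_itv/= => /andP[_ x1].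
  have d := is_derive_onem_powR (c + 1) x1.
  have := is_deriveZ (- (c + 1)^-1) d.
  by move=> /is_derive_eq; apply; rewrite /GRing.scale/= addrK; field; lra.
- by move=> x _; rewrite powR_ge0.
- have -> : (c + 1)^-1 * 2 `^ (c + 1) =
      - (c + 1)^-1 * 0 - - (c + 1)^-1 * 2 `^ (c + 1).
    by rewrite mulr0 sub0r mulNr opprK.
  apply: cvgB; (apply: cvgM; first exact: cvg_cst).
    under eq_fun do rewrite subKr.
    by apply: powR_cvg0_seq => // n; rewrite invr_gt0.
  by apply: powR_cvg_seq => //; under eq_fun do rewrite opprK.
Qed.

Lemma integrable_onep_powR c : -1 < c ->
  mu.-integrable `]-1, 1[ (EFin \o (fun x : R => (1 + x) `^ c)).
Proof.
move=> c1; have c0 : 0 < c + 1 by lra.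
apply/integrableP; split.
  apply/measurable_EFinP/measurable_funTS.
  apply: (measurableT_comp (measurable_powR c)) => //.
  exact: measurable_funD.
under eq_integral do rewrite /= ger0_norm ?powR_ge0//.
rewrite (@ge0_improper_FTC _ _ (fun x => (c + 1)^-1 * (1 + x) `^ (c + 1)) u
  u_nd u01 u1 _ _ ((c + 1)^-1 * 2 `^ (c + 1))) ?ltry//.
- move=> x; rewrite in_itv/= => /andP[x1 _].
  apply/differentiable_continuous/derivable1_diffP.
  have := is_derive_onep_powR c x1 => ?; exact: ex_derive.
- move=> x; rewrite in_itv/= => /andP[x1 _].
  have d := is_derive_onep_powR (c + 1) x1.
  have := is_deriveZ ((c + 1)^-1) d.
  by move=> /is_derive_eq; apply; rewrite /GRing.scale/= addrK; field; lra.
- by move=> x _; rewrite powR_ge0.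
- have -> : (c + 1)^-1 * 2 `^ (c + 1) =
      (c + 1)^-1 * 2 `^ (c + 1) - (c + 1)^-1 * 0.
    by rewrite mulr0 subr0.
  apply: cvgB; (apply: cvgM; first exact: cvg_cst); last first.
    under eq_fun do rewrite subKr.
    by apply: powR_cvg0_seq => // n; rewrite invr_gt0.
  exact: powR_cvg_seq.
Qed.

Let powR_le2 b (y : R) : 1 <= y <= 2 -> y `^ b <= 2 `^ `|b|.
Proof.
move=> /andP[y1 y2]; apply: (@le_trans _ _ (y `^ `|b|)).
  by apply: ler_powR => //; exact: ler_norm.
by apply: ge0_ler_powR => //; rewrite nnegrE; lra.
Qed.

Lemma integrable_jacobi_weight a b : -1 < a -> -1 < b ->
  mu.-integrable `]-1, 1[ (EFin \o jacobi_weight a b).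
Proof.
move=> a1 b1.
pose g x := 2 `^ `|b| * (1 - x) `^ a + 2 `^ `|a| * (1 + x) `^ b.
have gi : mu.-integrable `]-1, 1[ (EFin \o g).
  have i1 : mu.-integrable `]-1, 1[
      (fun x => ((2 `^ `|b|)%:E * ((1 - x) `^ a)%:E)%E).
    by apply: integrableZl => //; exact: integrable_onem_powR.
  have i2 : mu.-integrable `]-1, 1[
      (fun x => ((2 `^ `|a|)%:E * ((1 + x) `^ b)%:E)%E).
    by apply: integrableZl => //; exact: integrable_onep_powR.
  by have := integrableD _ i1 i2; apply.
apply: le_integrable gi => //.
  by apply/measurable_EFinP/measurable_funTS; exact: measurable_jacobi_weight.
move=> x /=; rewrite in_itv/= => /andP[x1 x2].
rewrite lee_fin ger0_norm ?jacobi_weight_ge0//.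
rewrite ger0_norm; last by rewrite /g addr_ge0// mulr_ge0// powR_ge0.
rewrite /g /jacobi_weight; have [x0|x0] := leP 0 x.
  rewrite -[leLHS]addr0 lerD ?mulr_ge0 ?powR_ge0//.
  by rewrite mulrC ler_wpM2r ?powR_ge0// powR_le2//; apply/andP; split; lra.
rewrite -[leLHS]add0r lerD ?mulr_ge0 ?powR_ge0//.
by rewrite ler_wpM2r ?powR_ge0// powR_le2//; apply/andP; split; lra.
Qed.

(** The polynomial q such that (p w)' = q w, for w the Jacobi weight and p = 1
    - x^2; hence p Q' + q Q = (p w Q)' / w for every Q. *)
Definition drift a b : {poly R} := (b - a)%:P - (a + b + 2)%:P * 'X.

Lemma jacobi_weightS a b x : x \in `]-1, 1[ ->
  jacobi_weight (a + 1) (b + 1) x = (1 - x ^+ 2) * jacobi_weight a b x.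
Proof.
rewrite in_itv/= => /andP[x1 x2].
have x1' : 0 < 1 - x by lra.
have x2' : 0 < 1 + x by lra.
rewrite /jacobi_weight !powRD ?(gt_eqF x1') ?(gt_eqF x2') ?implybT//.
rewrite !powRr1 ?ltW//; ring.
Qed.

(** The integrand is (p w Q)', and p w, the weight with exponents a + 1 and b +
    1, vanishes at both endpoints. *)
Lemma integral_divergence a b (Q : {poly R}) : -1 < a -> -1 < b ->
  mu.-integrable `]-1, 1[ (EFin \o (fun x =>
    ((1 - 'X^2) * Q^`() + drift a b * Q).[x] * jacobi_weight a b x)) ->
  \int[mu]_(x in `]-1, 1[)
    (((1 - 'X^2) * Q^`() + drift a b * Q).[x] * jacobi_weight a b x) = 0.
Proof.
move=> a1 b1 fi.
apply: (@improper_FTC _ _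
  (fun x => jacobi_weight (a + 1) (b + 1) x * Q.[x]) u u_nd u01 u1) => //.
- move=> x x01.
  apply/differentiable_continuous/derivable1_diffP.
  have := is_derive_jacobi_weight a b x01 => ?; exact: ex_derive.
- move=> x x01.
  have d1 := is_derive_jacobi_weight (a + 1) (b + 1) x01.
  have d2 : is_derive x 1 (horner Q) (Q^`()).[x] by exact: is_derive_poly.
  have := is_deriveM d1 d2.
  move=> /is_derive_eq; apply; rewrite /GRing.scale/= !addrK.
  rewrite jacobi_weightS// /drift !hornerE /=; ring.
- have Qc y : horner Q x @[x --> y] --> Q.[y] by exact: continuous_horner.
  have Nu1 : - u n @[n --> \oo] --> (-1 : R) by exact: cvgN.
  have Qu y (v : nat -> R) : v n @[n --> \oo] --> y ->
      Q.[v n] @[n --> \oo] --> Q.[y].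
    by move=> vy; apply: (cvg_comp v _ vy (Qc y)).
  have p0 c : -1 < c -> (1 - u n) `^ (c + 1) @[n --> \oo] --> (0 : R).
    move=> c1; under eq_fun do rewrite subKr.
    apply: powR_cvg0_seq => //; lra.
  have right0 : jacobi_weight (a + 1) (b + 1) (u n) @[n --> \oo] --> (0 : R).
    have := cvgM (p0 _ a1) (powR_cvg_seq (c := b + 1) _ u2).
    by rewrite mul0r; apply.
  have left0 : jacobi_weight (a + 1) (b + 1) (- u n) @[n --> \oo] --> (0 : R).
    have v2 : 1 - (- u n) @[n --> \oo] --> (2 : R).
      by under eq_fun do rewrite opprK.
    have := cvgM (powR_cvg_seq (c := a + 1) _ v2) (p0 _ b1).
    by rewrite mulr0; apply.
  have := cvgB (cvgM right0 (Qu _ _ u1)) (cvgM left0 (Qu _ _ Nu1)).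
  by rewrite !mul0r subr0; apply.
Qed.

End powers.

(** * Integration against a Jacobi weight *)

Section jacobi_functional.
Context {R : realType}.
Local Notation mu := (@lebesgue_measure R).
Implicit Types (a b c x : R) (f g : R -> R) (P Q : {poly R}).

(** A class of integrands that is integrable for every Jacobi weight with
    exponents above -1, and stable under the operations used below. *)
Definition bdd_measurable f :=
  measurable_fun (`]-1, 1[%classic : set R) f /\
  exists K, forall x : R, x \in `]-1, 1[ -> `|f x| <= K.

Definition jint a b f : R :=
  \int[mu]_(x in `]-1, 1[) (f x * jacobi_weight a b x).

Lemma bdd_measurable_poly P : bdd_measurable (horner P).
Proof.
split; first by apply: measurable_funTS; exact: measurable_poly.
have Pc : {within `[(-1 : R), 1], continuous (fun x => `|P.[x]|)}.
  apply: continuous_in_subspaceT => x _.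
  by apply: continuous_comp; [exact: continuous_horner|exact: norm_continuous].
have [|m _ mP] := EVT_max _ Pc; first lra.
exists `|P.[m]| => x /subset_itv_oo_cc; exact: mP.
Qed.

Lemma bdd_measurable_eq_poly f P : (forall x, f x = P.[x]) -> bdd_measurable f.
Proof. by move=> fP; rewrite (_ : f = horner P);
  [exact: bdd_measurable_poly|exact/funext]. Qed.

Lemma bdd_measurableD f g : bdd_measurable f -> bdd_measurable g ->
  bdd_measurable (fun x => f x + g x).
Proof.
move=> [mf [K fK]] [mg [L gL]]; split; first exact: measurable_funD.
by exists (K + L) => x x1; rewrite (le_trans (ler_normD _ _))// lerD ?fK ?gL.
Qed.

Lemma bdd_measurableM f g : bdd_measurable f -> bdd_measurable g ->
  bdd_measurable (fun x => f x * g x).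
Proof.
move=> [mf [K fK]] [mg [L gL]]; split; first exact: measurable_funM.
by exists (K * L) => x x1; rewrite normrM ler_pM// ?fK ?gL.
Qed.

Lemma bdd_measurable_cst c : bdd_measurable (fun=> c).
Proof. by split=> //; exists `|c|. Qed.

Lemma bdd_measurableN f : bdd_measurable f -> bdd_measurable (fun x => - f x).
Proof.
move=> [mf [K fK]]; split; first exact: measurable_funN.
by exists K => x x1; rewrite normrN fK.
Qed.

Lemma integrable_jint a b f : -1 < a -> -1 < b -> bdd_measurable f ->
  mu.-integrable `]-1, 1[ (EFin \o (fun x => f x * jacobi_weight a b x)).
Proof.
move=> a1 b1 [mf [K fK]].
have i1 : mu.-integrable `]-1, 1[
    (fun x => (K%:E * (jacobi_weight a b x)%:E)%E).
  by apply: integrableZl => //; exact: integrable_jacobi_weight.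
apply: le_integrable i1 => //.
  apply/measurable_EFinP/measurable_funM => //.
  by apply/measurable_funTS; exact: measurable_jacobi_weight.
move=> x x1; rewrite /= lee_fin !normrM ler_wpM2r//.
by rewrite (le_trans (fK _ x1))// ler_norm.
Qed.

Lemma eq_jint a b f g : (forall x : R, x \in `]-1, 1[ -> f x = g x) ->
  jint a b f = jint a b g.
Proof. by move=> fg; apply: eq_Rintegral => x; rewrite inE => /fg ->. Qed.

Section pos.
Variables (a b : R).
Hypotheses (a1 : -1 < a) (b1 : -1 < b).

Lemma jintD f g : bdd_measurable f -> bdd_measurable g ->
  jint a b (fun x => f x + g x) = jint a b f + jint a b g.
Proof.
move=> tf tg; rewrite /jint -RintegralD//; try exact: integrable_jint.
by apply: eq_Rintegral => x _; rewrite mulrDl.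
Qed.

Lemma jintZ c f : bdd_measurable f ->
  jint a b (fun x => c * f x) = c * jint a b f.
Proof.
move=> tf; rewrite /jint -RintegralZl//; last exact: integrable_jint.
by apply: eq_Rintegral => x _; rewrite mulrA.
Qed.

Lemma le_jint f g : bdd_measurable f -> bdd_measurable g ->
  (forall x : R, x \in `]-1, 1[ -> f x <= g x) -> jint a b f <= jint a b g.
Proof.
move=> tf tg fg; apply: le_Rintegral => //; try exact: integrable_jint.
by move=> x /fg; apply: ler_wpM2r; exact: jacobi_weight_ge0.
Qed.

Lemma ler_norm_jint f g : bdd_measurable f -> bdd_measurable g ->
  (forall x : R, x \in `]-1, 1[ -> `|f x| <= g x) -> `|jint a b f| <= jint a b g.
Proof.
move=> tf tg fg; rewrite ler_norml; apply/andP; split; last first.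
  by apply: le_jint => // x /fg; apply: le_trans; exact: ler_norm.
rewrite -mulN1r -jintZ//; apply: le_jint => //.
  by apply: bdd_measurableM => //; exact: bdd_measurable_cst.
by move=> x /fg; rewrite ler_norml mulN1r => /andP[].
Qed.

Lemma jint_ge0 f : (forall x : R, x \in `]-1, 1[ -> 0 <= f x) ->
  0 <= jint a b f.
Proof.
by move=> f0; apply: Rintegral_ge0 => x /f0 fx; rewrite mulr_ge0// jacobi_weight_ge0.
Qed.

Lemma jint_polyP c P Q :
  jint a b (horner (c *: P + Q)) = c * jint a b (horner P) + jint a b (horner Q).
Proof.
rewrite -jintZ; last exact: bdd_measurable_poly.
rewrite -jintD; last exact: bdd_measurable_poly.
  by apply: eq_jint => x _; rewrite !hornerE.
by apply: bdd_measurableM;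
  [exact: bdd_measurable_cst|exact: bdd_measurable_poly].
Qed.

Lemma jint_polyD P Q :
  jint a b (horner (P + Q)) = jint a b (horner P) + jint a b (horner Q).
Proof. by rewrite -[P in LHS]scale1r jint_polyP mul1r. Qed.

Lemma jint_poly0 : jint a b (horner 0) = 0.
Proof. by have := jint_polyD 0 0; rewrite addr0; lra. Qed.

Lemma jint_polyZ c P : jint a b (horner (c *: P)) = c * jint a b (horner P).
Proof. by rewrite -[X in horner X]addr0 jint_polyP jint_poly0 addr0. Qed.

Lemma jint_divergence Q :
  jint a b (horner ((1 - 'X^2) * Q^`() + drift a b * Q)) = 0.
Proof.
apply: integral_divergence => //; apply: integrable_jint => //.
exact: bdd_measurable_poly.
Qed.

End pos.

Lemma jint_shift a b f :
  jint (a + 1) (b + 1) f = jint a b (fun x => (1 - x ^+ 2) * f x).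
Proof.
apply: eq_Rintegral => x; rewrite inE => x1.
by rewrite jacobi_weightS//; ring.
Qed.

Lemma jint_shift_right a b f :
  jint (a + 1) b f = jint a b (fun x => (1 - x) * f x).
Proof.
apply: eq_Rintegral => x; rewrite inE/= in_itv/= => /andP[x1 x2].
have x0 : 0 < 1 - x by lra.
rewrite /jacobi_weight powRD ?(gt_eqF x0) ?implybT// powRr1 ?ltW//; ring.
Qed.

Lemma jint_shift_left a b f :
  jint a (b + 1) f = jint a b (fun x => (1 + x) * f x).
Proof.
apply: eq_Rintegral => x; rewrite inE/= in_itv/= => /andP[x1 x2].
have x0 : 0 < 1 + x by lra.
rewrite /jacobi_weight powRD ?(gt_eqF x0) ?implybT// powRr1 ?ltW//; ring.
Qed.

End jacobi_functional.

Section virial.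
Context {R : realType}.
Implicit Types (a b lam : R) (f g z P Q : {poly R}).

Definition eigenpoly a b lam z :=
  (1 - 'X^2) * z^`()^`() + drift a b * z^`() = lam%:P * z.

(** sqrt p (sqrt p g)' for p = 1 - x^2, whence the mean zero for the arcsine
    law. *)
Definition zero_mean g : {poly R} := (1 - 'X^2) * g^`() - 'X * g.

(** In the variable x = cos t this is the virial identity of a Schroedinger
    equation for the vector field sqrt p g. The factor h is chosen so that the
    terms in z'^2 cancel in the derivative of p w (p g z'^2 - h z z'); the last
    two terms of Q turn the products z z' that are left into multiples of
    z^2. *)
Lemma virial_poly (p q z g : {poly R}) lam :
  p * z^`()^`() + q * z^`() = lam%:P * z ->
  let h := p * g^`() - (q - p^`()) * g in
  let Q := 2 * g * p * z^`() * z^`() - 2 * h * z * z^`()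
     - 2 * lam%:P * (g * z * z) + h^`() * z * z in
  p * Q^`() + q * Q =
  ((p * h^`()^`() + q * h^`()) - 2 * lam%:P * (2 * p * g^`() + p^`() * g)) * (z * z).
Proof.
move=> ode h Q; apply/eqP; rewrite -subr_eq0.
set rhs := (X in _ - X).
have -> : p * Q^`() + q * Q - rhs =
    (4 * p * g * z^`() - 2 * h * z) * (p * z^`()^`() + q * z^`() - lam%:P * z).
  rewrite /rhs /Q {rhs Q}.
  have hE0 : h = p * g^`() - (q - p^`()) * g by [].
  clearbody h; set h' := h^`(); set h'' := h'^`().
  have hE : h^`() = h' by [].
  have hE' : h'^`() = h'' by [].
  have n2 : (2 : {poly R})^`() = 0 by rewrite -polyC_natr derivC.
  clearbody h'' h'.
  rewrite !(n2, derivD, derivN, derivM, derivC) hE hE' hE0.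
  ring.
by rewrite ode subrr mulr0.
Qed.

End virial.

(** * The arcsine law on polynomials *)

Section equilibrium_functional.
Context {R : realType}.
Local Notation mu := (@lebesgue_measure R).
Implicit Types (a b c x lam : R) (g P Q : {poly R}).

Lemma equilibrium_densityE x : x \in `]-1, 1[ ->
  equilibrium_density x = pi^-1 * jacobi_weight (- 2^-1) (- 2^-1) x.
Proof.
rewrite in_itv/= => /andP[x1 x2].
rewrite /equilibrium_density invfM /jacobi_weight; congr (_ * _).
rewrite -powRM; [|lra|lra].
have -> : (1 - x) * (1 + x) = 1 - x ^+ 2 by ring.
by rewrite powRN powR12_sqrt//; nra.
Qed.

(** - acos is a primitive. The exhausting intervals end at - cos t and cos t,
    where acos is explicit. *)
Lemma integral_arcsine :
  (\int[mu]_(x in `](-1)%R, 1%R[) ((Num.sqrt (1 - x ^+ 2))^-1)%:E = (pi : R)%:E)%E.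
Proof.
pose t n : R := n.+2%:R^-1.
have t01 n : 0 < t n < 1.
  by rewrite /t invr_gt0 ltr0n/= invf_lt1// ltr1n.
have t0 : t n @[n --> \oo] --> (0 : R).
  by have := @cvg_harmonic R; rewrite -cvg_shiftS.
have pi2 : 2 <= (pi : R) by exact: pi_ge2.
have d (x : R) : x \in `]-1, 1[ -> is_derive x 1 (fun y : R => - acos y)
    ((Num.sqrt (1 - x ^+ 2))^-1).
  rewrite in_itv/= => x1; have dx := is_derive1_acos x1.
  by have := is_deriveN dx => /is_derive_eq; apply; rewrite opprK.
have tpi n : t n \in `[0, pi].
  by rewrite in_itv/=; have /andP[? ?] := t01 n; apply/andP; split; lra.
have acosu n : acos (cos (t n)) = t n by rewrite cosK.
apply: (@ge0_improper_FTC _ _ (fun y : R => - acos y) (fun n => cos (t n))) => //.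
- apply/nondecreasing_seqP => n; rewrite leNgt ltr_cos// -leNgt.
  by rewrite /t lef_pV2 ?posrE// ler_nat.
- move=> n; have /andP[tn0 tn1] := t01 n; apply/andP; split.
    by apply: cos_gt0_pihalf; apply/andP; split; lra.
  by rewrite -[ltRHS]cos0 ltr_cos// in_itv/= lexx pi_ge0.
- by rewrite -[X in _ --> X]cos0; apply: (cvg_comp t cos t0); exact: continuous_cos.
- move=> x; rewrite in_itv/= => /andP[x1 x2].
  have x0 : 0 < 1 - x ^+ 2 by nra.
  apply: cvgV; first by rewrite sqrtr_eq0 -ltNge.
  apply: continuous_comp; last exact: sqrt_continuous.
  by apply: cvgB; [exact: cvg_cst|exact: exprn_continuous].
- rewrite (_ : (fun n => _) = (fun n => pi - 2 * t n)); last first.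
    apply/funext => n /=; rewrite acosN; last by rewrite cos_geN1 cos_le1.
    by rewrite acosu; ring.
  rewrite -[X in _ --> X]subr0 -(mulr0 2).
  by apply: cvgB; [exact: cvg_cst|apply: cvgM => //; exact: cvg_cst].
Qed.

(** The integral against the equilibrium measure, whose density is a multiple
    of the Jacobi weight with both exponents - 1/2. *)
Definition equilibrium_functional Q : R :=
  pi^-1 * jint (- 2^-1) (- 2^-1) (horner Q).

Lemma equilibrium_functional1 : equilibrium_functional 1 = 1.
Proof.
have pi2 : 2 <= (pi : R) by exact: pi_ge2.
rewrite /equilibrium_functional (_ : jint _ _ _ = pi); first by field; lra.
rewrite /jint /Rintegral -[RHS]/(fine pi%:E) -integral_arcsine; congr fine.
apply: eq_integral => x; rewrite inE => x1; congr (_%:E).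
have := equilibrium_densityE x1.
rewrite /equilibrium_density invfM -[1 : {poly R}]/(1%:P) hornerC mul1r.
by move=> /mulfI ->//; rewrite invr_eq0; lra.
Qed.

(** For the exponents - 1/2 the drift is - x, so that p g' - x g is a
    divergence. *)
Lemma equilibrium_functional_zero_mean g :
  equilibrium_functional (zero_mean g) = 0.
Proof.
rewrite /equilibrium_functional.
have /= := @jint_divergence R (- 2^-1) (- 2^-1) _ _ g.
have -> : (1 - 'X^2) * g^`() + drift (- 2^-1) (- 2^-1) * g = zero_mean g.
  rewrite /drift /zero_mean subrr (_ : _ + 2 = 1); last by field.
  by rewrite mul1r sub0r mulNr.
by move=> ->; rewrite ?mulr0//; lra.
Qed.

Lemma equilibrium_functionalP c P Q :
  equilibrium_functional (c *: P + Q) =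
  c * equilibrium_functional P + equilibrium_functional Q.
Proof. by rewrite /equilibrium_functional jint_polyP; [ring|lra|lra]. Qed.

(** The constants and the polynomials p g' - x g span everything: for g =
    x^(k+1) the latter is (k + 1) x^k - (k + 2) x^(k+2), which gives all the
    monomials by induction. *)
Lemma cvg_equilibrium_functional (l : nat -> {poly R} -> R) :
  (forall n c P Q, l n (c *: P + Q) = c * l n P + l n Q) ->
  l n 1 @[n --> \oo] --> (1 : R) ->
  (forall g, l n (zero_mean g) @[n --> \oo] --> (0 : R)) ->
  forall Q, l n Q @[n --> \oo] --> equilibrium_functional Q.
Proof.
move=> lP l1 l0.
pose good Q := l n Q @[n --> \oo] --> equilibrium_functional Q.
have goodP c P Q : good P -> good Q -> good (c *: P + Q).
  move=> gP gQ; rewrite /good equilibrium_functionalP.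
  rewrite (_ : (fun n => l n _) = (fun n => c * l n P + l n Q)); last first.
    by apply/funext => n; rewrite lP.
  by apply: cvgD => //; apply: cvgM => //; exact: cvg_cst.
have good1 : good 1 by rewrite /good equilibrium_functional1.
have good0 : good 0.
  by have := goodP (-1) _ _ good1 good1; rewrite scaleN1r addNr.
have goodz g : good (zero_mean g).
  by rewrite /good equilibrium_functional_zero_mean.
have goodX k : good 'X^k.
  elim/ltn_ind: k => -[|[|k]] ih.
  - by rewrite expr0.
  - have := goodP (-1) _ _ (goodz 1) good0.
    by rewrite /zero_mean derivC mulr0 mulr1 sub0r scaleN1r opprK addr0.
  - have k2 : k.+2%:R != 0 :> R by rewrite pnatr_eq0.
    have e : ('X^(k.+2) : {poly R}) = (- k.+2%:R^-1) *: zero_mean ('X^(k.+1)) +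
        ((k.+1%:R / k.+2%:R) *: ('X^k) + 0).
      apply: (scalerI k2); rewrite !scalerDr scaler0 addr0 !scalerA.
      rewrite mulrN mulfV// mulrCA mulfV// mulr1 scaleN1r.
      rewrite /zero_mean derivXn /= -!mul_polyC !exprS !polyC_natr.
      rewrite -mulr_natr; ring.
    rewrite e; apply: (goodP) => //; apply: goodP => //.
    exact: ih.
move=> Q; rewrite -[Q]coefK poly_def; elim/big_ind: _ => //.
- by move=> P P' gP gP'; have := goodP 1 _ _ gP gP'; rewrite scale1r.
- by move=> i _; have := goodP Q`_i _ _ (goodX i) good0; rewrite addr0.
Qed.

End equilibrium_functional.

Section eigen_cvg.
Context {R : realType}.
Implicit Types (a b c x lam : R) (g P Q : {poly R}).

(** The polynomial V of the virial identity: it depends on the weight and on g,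
    but not on the eigenpolynomial, so its bound on (-1, 1) is uniform. *)
Definition virial_potential a b g : {poly R} :=
  let h := (1 - 'X^2) * g^`() - (drift a b - (1 - 'X^2)^`()) * g in
  (1 - 'X^2) * h^`()^`() + drift a b * h^`().

Lemma virial a b lam g z : -1 < a -> -1 < b -> eigenpoly a b lam z ->
  4 * lam * jint a b (horner (zero_mean g * (z * z))) =
    jint a b (horner (virial_potential a b g * (z * z))).
Proof.
move=> a1 b1 ode.
have := virial_poly g ode => /= vp.
have := jint_divergence a1 b1
  (let h := (1 - 'X^2) * g^`() - (drift a b - (1 - 'X^2)^`()) * g in
   2 * g * (1 - 'X^2) * z^`() * z^`() - 2 * h * z * z^`()
     - 2 * lam%:P * (g * z * z) + h^`() * z * z) => /=.
rewrite vp -/(virial_potential a b g).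
have -> : (virial_potential a b g - 2 * lam%:P *
      (2 * (1 - 'X^2) * g^`() + (1 - 'X^2)^`() * g)) * (z * z) =
    (- (4 * lam)) *: (zero_mean g * (z * z)) + virial_potential a b g * (z * z).
  have -> : (1 - 'X^2)^`() = - 2 * 'X :> {poly R}.
    by rewrite derivB derivC derivXn sub0r mulNr -mulr_natl expr1.
  rewrite -mul_polyC polyCN polyCM polyC_natr /zero_mean; ring.
by rewrite jint_polyP//; lra.
Qed.

(** The virial identity bounds the mean of p g' - x g by a constant over lam n,
    so in the limit these means vanish, as they do for the arcsine law. *)
Lemma eigen_cvg a b (z : nat -> {poly R}) (lam : nat -> R) :
  -1 < a -> -1 < b ->
  (forall n, eigenpoly a b (lam n) (z n)) ->
  (\forall n \near \oo, lam n != 0) ->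
  (lam n)^-1 @[n --> \oo] --> (0 : R) ->
  (\forall n \near \oo, 0 < jint a b (horner (z n * z n))) ->
  forall Q, jint a b (horner (Q * (z n * z n))) / jint a b (horner (z n * z n))
    @[n --> \oo] --> equilibrium_functional Q.
Proof.
move=> a1 b1 ode lam0 lamV z0.
apply: (cvg_equilibrium_functional
  (l := fun n Q => jint a b (horner (Q * (z n * z n))) / jint a b (horner (z n * z n)))).
- by move=> n c P Q; rewrite [(c *: P + Q) * _]mulrDl -scalerAl jint_polyP// mulrDl mulrA.
- apply: cvg_near_cst; near=> n.
  by rewrite mul1r divff// gt_eqF//; near: n; exact: z0.
- move=> g.
  have [_ [K VK]] := bdd_measurable_poly (virial_potential a b g).
  apply: (@norm_cvg0 R R^o).
  apply: (@squeeze_cvgr _ _ _ _ (cst 0) (fun n => K / 4 * `|(lam n)^-1|)).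
  + near=> n.
    have ln0 : lam n != 0 by near: n; exact: lam0.
    have zn0 : 0 < jint a b (horner (z n * z n)) by near: n; exact: z0.
    rewrite normr_ge0/= normrM normfV (gtr0_norm zn0) ler_pdivrMr//.
    rewrite (_ : jint _ _ _ = (lam n)^-1 / 4 *
        jint a b (horner (virial_potential a b g * (z n * z n)))); last first.
      by rewrite -(virial _ a1 b1 (ode n)); field.
    have JV : `|jint a b (horner (virial_potential a b g * (z n * z n)))| <=
        K * jint a b (horner (z n * z n)).
      rewrite -jintZ//; last exact: bdd_measurable_poly.
      apply: ler_norm_jint => //; first exact: bdd_measurable_poly.
        by apply: bdd_measurableM;
  [exact: bdd_measurable_cst|exact: bdd_measurable_poly].
      by move=> x /VK xK; rewrite !hornerM normrM ler_pM//
        ger0_norm// -expr2 sqr_ge0.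
    rewrite normrM normrM (ger0_norm (_ : 0 <= 4^-1)) ?invr_ge0//.
    have -> : K / 4 * `|(lam n)^-1| * jint a b (horner (z n * z n)) =
      `|(lam n)^-1| / 4 * (K * jint a b (horner (z n * z n))) by ring.
    by rewrite ler_wpM2l// mulr_ge0// invr_ge0.
  + exact: cvg_cst.
  + rewrite -(mulr0 (K / 4)); apply: cvgM; first exact: cvg_cst.
    by have := cvg_norm lamV; rewrite normr0; apply.
Unshelve. all: by end_near. Qed.

End eigen_cvg.

(** * The Jacobi differential equation *)

Section jacobi_ode.
Context {R : realType}.
Implicit Types (a b c d x lam : R) (g y P Q : {poly R}).

Lemma eq_poly_itvoo P Q : (forall x : R, x \in `]-1, 1[ -> P.[x] = Q.[x]) ->
  P = Q.
Proof.
move=> PQ; apply/eqP; rewrite -subr_eq0; apply/eqP.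
pose rs := [seq (i.+2%:R : R)^-1 | i <- iota 0 (size (P - Q))].
apply: (@roots_geq_poly_eq0 _ _ rs).
- apply/allP => _ /mapP[i _ ->].
  rewrite /root hornerD hornerN PQ ?subrr// in_itv/=.
  by rewrite (lt_trans (ltrN10 _)) ?invr_gt0//= invf_lt1// ltr1n.
- rewrite map_inj_uniq ?iota_uniq// => i j /invr_inj /eqP.
  by rewrite eqr_nat => /eqP[].
- by rewrite size_map size_iota.
Qed.

(** Let P be the polynomial of the n-th derivative and q the drift for the
    exponents lowered by n + 1. The next polynomial is q P + p P', and the
    eigenvalue equation for P says exactly that the derivative of q P + p P' is
    a multiple mu P of P. Inserting this back gives the next eigenvalue
    equation, with eigenvalue mu. *)
Lemma rodrigues_eigenpoly c d n : exists2 P : {poly R},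
  eigenpoly (c - n%:R) (d - n%:R) (- (n%:R * (c + d - n%:R + 1))) P &
  forall x : R, x \in `]-1, 1[ ->
  derive1n n (jacobi_weight c d) x =
  jacobi_weight (c - n%:R) (d - n%:R) x * P.[x].
Proof.
elim: n => [|n [P ode ih]].
  exists 1; last by move=> x _; rewrite derive1n0 !subr0 hornerE mulr1.
  rewrite /eigenpoly !derivC mul0r oppr0 !mulr0 addr0 mul0r//.
pose q : {poly R} := (d - n%:R) *: (1 - 'X) - (c - n%:R) *: (1 + 'X).
exists (q * P + (1 - 'X^2) * P^`()).
  set lam := - (n%:R * (c + d - n%:R + 1)) in ode.
  pose mu := lam - (c + d - 2 * n%:R).
  have qE : drift (c - n%:R) (d - n%:R) = q - 2 * 'X.
    rewrite /drift /q -!mul_polyC !(polyCB, polyCD, polyC_natr); ring.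
  have qE' : drift (c - n.+1%:R) (d - n.+1%:R) = q.
    rewrite /drift /q -!mul_polyC !(polyCB, polyCD, polyC_natr) -natr1; ring.
  have dq : q^`() = - (c + d - 2 * n%:R)%:P.
    rewrite /q !poly.derivE -!mul_polyC !(polyCB, polyCD, polyCM, polyC_natr); ring.
  have dp : (1 - 'X^2)^`() = - 2 * 'X :> {poly R}.
    by rewrite derivB derivC derivXn sub0r mulNr -mulr_natl expr1.
  have d1 : (q * P + (1 - 'X^2) * P^`())^`() = mu%:P * P.
    have -> : mu%:P * P = lam%:P * P - (c + d - 2 * n%:R)%:P * P.
      by rewrite -mulrBl -polyCB.
    by rewrite derivD !derivM dq dp -ode qE; ring.
  rewrite /eigenpoly qE' d1 derivM derivC mul0r add0r.
  rewrite (_ : - _ = mu); last by rewrite /mu /lam -natr1; ring.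
  ring.
move=> x x01; rewrite derive1nS derive1E.
have near_x : \near x, derive1n n (jacobi_weight c d) x =
    (jacobi_weight (c - n%:R) (d - n%:R) * horner P) x.
  have : \near x, x \in `]-1, 1[ by exact: near_in_itvoo.
  by apply: filterS => y /ih.
rewrite (near_eq_derive _ near_x).
have D1 := is_derive_jacobi_weight (c - n%:R) (d - n%:R) x01.
have D2 : is_derive x 1 (horner P) (P^`()).[x] by exact: is_derive_poly.
have -> := @derive_val _ _ _ _ _ _ _ (is_deriveM D1 D2).
have := jacobi_weightS (c - n.+1%:R) (d - n.+1%:R) x01.
have e s : s - n.+1%:R + 1 = s - n%:R :> R by rewrite -natr1; ring.
have e' s : s - n%:R - 1 = s - n.+1%:R :> R by rewrite -natr1; ring.
rewrite !e !e' => ->; move: (jacobi_weight (c - n.+1%:R) (d - n.+1%:R) x) => J.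
rewrite /GRing.scale /q !hornerE /=; ring.
Qed.

Lemma eigenpolyZ a b lam c y : eigenpoly a b lam y -> eigenpoly a b lam (c *: y).
Proof.
rewrite /eigenpoly !derivZ => ode.
by rewrite -!scalerAr -scalerDr ode.
Qed.

Lemma jacobi_eigenpoly a b n :
  eigenpoly a b (- (n%:R * (n%:R + a + b + 1))) (jacobi a b n).
Proof.
have [P ode PE] := rodrigues_eigenpoly (a + n%:R) (b + n%:R) n.
have -> : jacobi a b n = ((-1) ^+ n / (2 ^+ n * n`!%:R)) *: P.
  apply: eq_poly_itvoo => x x01.
  have := jacobi_rodrigues a b n x01; rewrite PE// !addrK hornerZ mulrCA.
  apply: mulfI; move: x01; rewrite in_itv/= => /andP[x1 x2].
  by rewrite gt_eqF// mulr_gt0// powR_gt0; lra.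
apply: eigenpolyZ; move: ode; rewrite !addrK.
by rewrite (_ : a + n%:R + (b + n%:R) - n%:R + 1 = n%:R + a + b + 1)//; ring.
Qed.

(** Differentiating p y'' + q y' = lam y adds p' to the drift, which is the
    effect of raising both exponents by 1, and the constant - q' to the
    eigenvalue. *)
Lemma eigenpoly_deriv a b lam y : eigenpoly a b lam y ->
  eigenpoly (a + 1) (b + 1) (lam + (a + b + 2)) y^`().
Proof.
rewrite /eigenpoly => ode; have := congr1 (fun P => P^`()) ode.
have -> : drift (a + 1) (b + 1) = drift a b - 2 * 'X.
  rewrite /drift !(polyCB, polyCD, polyC_natr); ring.
have dq : (drift a b)^`() = - (a + b + 2)%:P.
  by rewrite /drift derivB derivM !derivC derivX; ring.
have dp : (1 - 'X^2)^`() = - 2 * 'X :> {poly R}.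
  by rewrite derivB derivC derivXn sub0r mulNr -mulr_natl expr1.
rewrite derivD !derivM derivC mul0r add0r dq dp => e.
rewrite polyCD [RHS]mulrDl -e; ring.
Qed.

(** Green's identity: the divergence of y y' is p y'^2 + lam y^2. *)
Lemma eigenpoly_energy a b lam y : -1 < a -> -1 < b -> eigenpoly a b lam y ->
  jint (a + 1) (b + 1) (horner (y^`() * y^`())) =
  - lam * jint a b (horner (y * y)).
Proof.
move=> a1 b1 ode; rewrite jint_shift.
have := jint_divergence a1 b1 (y * y^`()); rewrite derivM mulrDr.
have -> : (1 - 'X^2) * (y^`() * y^`()) + (1 - 'X^2) * (y * y^`()^`()) +
    drift a b * (y * y^`()) =
    lam *: (y * y) + (1 - 'X^2) * (y^`() * y^`()).
  rewrite -mul_polyC; have := congr1 (fun P => y * P) ode => e.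
  rewrite mulrA [y * _ in RHS]mulrC. 
  rewrite (_ : lam%:P * (y * y) = y * (lam%:P * y)); last by ring.
  by rewrite -e; ring.
rewrite jint_polyP// => e.
rewrite -[LHS]addr0 -e.
have -> : jint a b (fun x => (1 - x ^+ 2) * (y^`() * y^`()).[x]) =
  jint a b (horner ((1 - 'X^2) * (y^`() * y^`()))).
  by apply: eq_jint => x _; rewrite [RHS]hornerM !hornerE.
lra.
Qed.

End jacobi_ode.

(** * A Hardy inequality localised at an endpoint *)

Section bump.
Context {R : realType}.
Implicit Types (s c k a b x : R) (g y : {poly R}).

(** For s = 1 (respectively s = -1) this polynomial is at most 1 on (-1, 1) and
    concentrates at the endpoint 1 (respectively -1) as M grows. *)
Definition bump s M : {poly R} := (2^-1 *: (1 + s *: 'X)) ^+ M.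

Lemma horner_bump s M x : (bump s M).[x] = ((1 + s * x) / 2) ^+ M.
Proof. by rewrite /bump horner_exp !hornerE mulrC. Qed.

Lemma sign_itv s x : s ^+ 2 = 1 -> x \in `]-1, 1[ -> -1 < s * x < 1.
Proof.
move=> /eqP; rewrite sqrf_eq1 => /orP[] /eqP->; rewrite in_itv/= => /andP[x1 x2];
  apply/andP; split; lra.
Qed.

Lemma bump_deriv s M : s ^+ 2 = 1 ->
  (1 - 'X^2) * (bump s M)^`() = (s * M%:R) *: ((1 - s *: 'X) * bump s M).
Proof.
move=> s2; case: M => [|M].
  by rewrite /bump expr0 derivC mulr0 mulr0 scale0r.
have dB : (2^-1 *: (1 + s *: 'X) : {poly R})^`() = (2^-1 * s)%:P.
  by rewrite derivZ derivD derivC derivZ derivX add0r alg_polyC -mul_polyC polyCM.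
rewrite /bump deriv_exp dB /= exprSr.
have -> : (1 - 'X^2) = 2 *: ((1 - s *: 'X) * (2^-1 *: (1 + s *: 'X))) :> {poly R}.
  rewrite -scalerAr scalerA mulfV ?pnatr_eq0// scale1r.
  rewrite -!mul_polyC; have : (s ^+ 2)%:P = 1 :> {poly R} by rewrite s2.
  by rewrite polyC_exp => e; ring: e.
set B := 2^-1 *: _.
have h2 : (2 : {poly R}) * (2^-1)%:P = 1.
  by rewrite -polyC_natr -polyCM mulfV// pnatr_eq0.
rewrite -!mul_polyC -[_ *+ M.+1]mulr_natr !polyCM !polyC_natr exprS.
set m := M.+1%:R.
transitivity (2 * (2^-1)%:P * (s%:P * m * ((1 - s%:P * 'X) * (B * B ^+ M)))).
  by ring.
by rewrite h2 mul1r.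
Qed.

(** p g' - x g, for g the bump of exponent M, is a combination of the bumps of
    exponents M and M + 1, and its mean vanishes. *)
Lemma equilibrium_bump_rec s M : s ^+ 2 = 1 ->
  equilibrium_functional (bump s M.+1) =
  (2 * M%:R + 1) / (2 * M%:R + 2) * equilibrium_functional (bump s M).
Proof.
move=> s2.
have e : zero_mean (bump s M) = (- (s * (2 * M%:R + 2))) *: bump s M.+1 +
    ((s * (2 * M%:R + 1)) *: bump s M + 0).
  rewrite /zero_mean bump_deriv// {3}/bump exprS -/(bump s M).
  rewrite -!mul_polyC !(polyCN, polyCM, polyC_natr, polyC1, polyCD).
  have e2 : (s%:P : {poly R}) ^+ 2 = 1 by rewrite -polyC_exp s2.
  have h2 : (2 : {poly R}) * (2^-1)%:P = 1.
    by rewrite -polyC_natr -polyCM mulfV// pnatr_eq0.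
  set m := M%:R; set B := bump s M.
  transitivity (- (2 * (2^-1)%:P) * (s%:P * (m + 1) * ((1 + s%:P * 'X) * B))
      + s%:P * (2 * m + 1) * B).
    by rewrite h2; ring: e2.
  by ring.
have s0 : s != 0 by rewrite -sqrf_eq0 s2 oner_eq0.
have M0 : 2 * M%:R + 2 != 0 :> R by rewrite -natrM -natrD pnatr_eq0 addn2.
have := equilibrium_functional_zero_mean (bump s M).
have E0 : equilibrium_functional (0 : {poly R}) = 0.
  have := equilibrium_functionalP 1 (0 : {poly R}) 0.
  by rewrite scaler0 addr0; lra.
rewrite e !equilibrium_functionalP E0 addr0 mulNr => /eqP.
rewrite addrC subr_eq0 => /eqP; rewrite -!mulrA => /(mulfI s0) h.
by apply: (mulfI M0); rewrite -h; field.
Qed.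

(** The product of the factors (2 M + 1) / (2 M + 2) decays like M^(-1/2). *)
Lemma equilibrium_bump_le s M : s ^+ 2 = 1 ->
  equilibrium_functional (bump s M) ^+ 2 * (2 * M%:R + 1) <= 1.
Proof.
move=> s2; elim: M => [|M ih].
  by rewrite /bump expr0 equilibrium_functional1 mulr0 add0r expr1n mulr1.
rewrite equilibrium_bump_rec//; apply: le_trans ih.
set E := equilibrium_functional _; set m : R := M%:R.
have m0 : 0 <= m by exact: ler0n.
have -> : ((2 * m + 1) / (2 * m + 2) * E) ^+ 2 * (2 * M.+1%:R + 1) =
   E ^+ 2 * (2 * m + 1) * ((2 * m + 1) * (2 * m + 3) / (2 * m + 2) ^+ 2).
  by rewrite -natr1 -/m; field; lra.
rewrite ler_piMr//.
  by rewrite mulr_ge0// ?sqr_ge0//; lra.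
by rewrite ler_pdivrMr ?exprn_gt0//; nra.
Qed.

Lemma equilibrium_bump_small s (eps : R) : s ^+ 2 = 1 -> 0 < eps ->
  exists M, equilibrium_functional (bump s M.+1) < eps.
Proof.
move=> s2 e0.
pose M := Num.truncn (eps ^- 2).
exists M; rewrite ltNge; apply/negP => eE.
have := equilibrium_bump_le M.+1 s2.
set E := equilibrium_functional _ in eE *.
have Me : eps ^- 2 < M.+1%:R by exact: truncnS_gt.
have e2 : 0 < eps ^+ 2 by rewrite exprn_gt0.
have : 1 < eps ^+ 2 * M.+1%:R.
  by rewrite -ltr_pdivrMl// mulr1.
have : eps ^+ 2 <= E ^+ 2 by rewrite ler_pXn2r// ?nnegrE; lra.
have := ler0n R M.+1.
nra.
Qed.

Lemma bernoulli_onem (u : R) M : 0 <= u <= 1 -> 1 - M%:R * u <= (1 - u) ^+ M.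
Proof.
move=> /andP[u0 u1]; elim: M => [|M ih]; first by rewrite mul0r subr0 expr0.
rewrite exprS -natr1; apply: (@le_trans _ _ ((1 - u) * (1 - M%:R * u))).
  by have := ler0n R M; nra.
by rewrite ler_wpM2l//; lra.
Qed.

End bump.

Section hardy.
Context {R : realType}.
Implicit Types (s c k a b x : R) (g y : {poly R}).

(** The drift condition says that the weight has exponent k - 1 at the endpoint
    s. For G the bump and t = 1 - s x, s times the divergence of G y^2 equals
    (M + c) t G y^2 - 2 k G y^2 + 2 s p G y y'. Its integral vanishes, and the
    cross term is absorbed by k G y^2 + p^2 G y'^2 / k. Replacing k G y^2 by k
    y^2 costs k M t y^2 / 2, by Bernoulli's inequality. *)
Lemma hardy s k c a b M y : s ^+ 2 = 1 -> -1 < a -> -1 < b -> 0 < k ->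
  drift a b = s *: (c *: (1 - s *: 'X) - (2 * k)%:P) ->
  k * jint a b (horner (y * y)) <=
  (`|M%:R + c| + k * M%:R / 2) * jint a b (horner ((1 - s *: 'X) * (y * y))) +
  k^-1 * jint a b (horner ((1 - 'X^2) ^+ 2 * bump s M * (y^`() * y^`()))).
Proof.
move=> s2 a1 b1 k0 dE.
pose D := (1 - 'X^2) * (bump s M * (y * y))^`() + drift a b * (bump s M * (y * y)).
have D0 : jint a b (horner D) = 0 by exact: jint_divergence.
rewrite -!jint_polyZ// -jint_polyD//.
rewrite -[leLHS]addr0 -(mulr0 s) -D0 -jint_polyZ// -jint_polyD//.
apply: le_jint => //; try exact: bdd_measurable_poly.
move=> x x1.
have /andP[sx1 sx2] := sign_itv s2 x1.
have De : D = s *: ((M%:R + c) *: ((1 - s *: 'X) * bump s M * (y * y)))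
   - (2 * k * s) *: (bump s M * (y * y))
   + 2 *: ((1 - 'X^2) * bump s M * (y * y^`())).
  have -> : D = (1 - 'X^2) * (bump s M)^`() * (y * y) +
      (1 - 'X^2) * bump s M * (2 * (y * y^`())) + drift a b * (bump s M * (y * y)).
    by rewrite /D !derivM; ring.
  rewrite bump_deriv// dE.
  rewrite -!mul_polyC !(polyCN, polyCM, polyC_natr, polyC1, polyCD); ring.
have -> : (k *: (y * y) + s *: D).[x] = k * y.[x] ^+ 2 +
   (s ^+ 2 * ((M%:R + c) * (1 - s * x) - 2 * k) * y.[x] ^+ 2
    + 2 * s * (1 - x ^+ 2) * y.[x] * y^`().[x]) * (bump s M).[x].
  by rewrite De; move: (bump s M) => G; rewrite !hornerE /=; ring.
rewrite s2 mul1r !hornerE /=.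
set g := (bump s M).[x]; set Y := y.[x]; set Z := y^`().[x].
set t := 1 - s * x; set p := 1 - x ^+ 2.
have t0 : 0 < t by rewrite /t; lra.
have gE : g = (1 - t / 2) ^+ M.
  by rewrite /g horner_bump /t; congr (_ ^+ _); field.
have g0 : 0 <= g by rewrite gE exprn_ge0// /t; lra.
have g1 : g <= 1 by rewrite gE exprn_ile1// /t; lra.
have gM : 1 - M%:R * (t / 2) <= g.
  by rewrite gE; apply: bernoulli_onem; rewrite /t; apply/andP; split; lra.
have amgm : 2 * s * p * Y * Z * g <= (k * Y ^+ 2 + k^-1 * p ^+ 2 * Z ^+ 2) * g.
  apply: ler_wpM2r => //; rewrite -subr_ge0.
  have -> : k * Y ^+ 2 + k^-1 * p ^+ 2 * Z ^+ 2 - 2 * s * p * Y * Z =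
    k^-1 * (k * Y - s * p * Z) ^+ 2 + k^-1 * (1 - s ^+ 2) * p ^+ 2 * Z ^+ 2.
    by field; lra.
  by rewrite s2 subrr mulr0 !mul0r addr0 mulr_ge0 ?sqr_ge0// invr_ge0 ltW.
have h1 : k * (1 - g) * Y ^+ 2 <= k * M%:R / 2 * t * Y ^+ 2.
  by apply: ler_wpM2r; [exact: sqr_ge0|nra].
have h2 : (M%:R + c) * t * g * Y ^+ 2 <= `|M%:R + c| * t * Y ^+ 2.
  rewrite ler_wpM2r ?sqr_ge0// mulrAC ler_wpM2r ?(ltW t0)//.
  by rewrite (le_trans (ler_norm _))// normrM (ger0_norm g0) ler_piMr.
have -> : (2^-1 * (1 + s * x)) ^+ M = g.
  by rewrite /g horner_bump; congr (_ ^+ _); ring.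
move: g Y Z t p {t0 g0 g1 gM gE De D D0 dE} amgm h1 h2 => g Y Z t p amgm h1 h2.
lra.
Qed.

End hardy.

(** * Asymptotics of Jacobi polynomials *)

Section asymptotics.
Context {R : realType}.
Implicit Types (s c k : R) (Q : {poly R}) (n : nat).
Variables (a b : R) (y : nat -> {poly R}).
Hypotheses (a1 : -1 < a) (b1 : -1 < b).

Definition jacobi_energy n : R := n%:R * (n%:R + a + b + 1).

Lemma cvg_invr0 (v : nat -> R) (d : R) : 0 < d ->
  (\forall n \near \oo, d * n%:R <= v n) -> (v n)^-1 @[n --> \oo] --> (0 : R).
Proof.
move=> d0 dv; apply: (@squeeze_cvgr _ _ _ _ (cst 0) (fun n => d^-1 * n%:R^-1)).
- near=> n.
  have n0 : 0 < n%:R :> R by rewrite ltr0n; near: n; exact: nbhs_infty_gt.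
  have dn0 : 0 < d * n%:R by rewrite mulr_gt0.
  have dn : d * n%:R <= v n by near: n; exact: dv.
  rewrite -invfM; apply/andP; split.
    by rewrite invr_ge0 (le_trans _ dn)// ltW.
  by rewrite lef_pV2// posrE// (lt_le_trans dn0).
- exact: cvg_cst.
- rewrite -(mulr0 d^-1); apply: cvgM; first exact: cvg_cst.
  have := @cvg_harmonic R; rewrite -(cvg_shiftS (fun n => n%:R^-1 : R)); apply.
Unshelve. all: by end_near. Qed.

Let ab2 : 0 < a + b + 2. Proof. by move: a1 b1; lra. Qed.

Lemma jacobi_energy_ge n : (a + b + 2) * n%:R <= jacobi_energy n.
Proof.
case: n => [|n]; first by rewrite /jacobi_energy mul0r mulr0.
rewrite /jacobi_energy mulrC ler_wpM2l//.
by have := ler0n R n; have := natr1 n; move: ab2; lra.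
Qed.

Lemma cvg_jacobi_energyV : (jacobi_energy n)^-1 @[n --> \oo] --> (0 : R).
Proof.
apply: (@cvg_invr0 _ (a + b + 2)); first exact: ab2.
by apply: nearW => n; exact: jacobi_energy_ge.
Qed.

Hypothesis ode : forall n, eigenpoly a b (- jacobi_energy n) (y n).
Hypothesis y0 : forall n, 0 < jint a b (horner (y n * y n)).

(** The integral of Q y'^2 p w, where the factor p raises both exponents by
    1. *)
Definition dirichlet n Q : R :=
  jint (a + 1) (b + 1) (horner (Q * ((y n)^`() * (y n)^`()))).

Let a11 : -1 < a + 1. Proof. by move: a1; lra. Qed.
Let b11 : -1 < b + 1. Proof. by move: b1; lra. Qed.

Lemma dirichlet1 n :
  dirichlet n 1 = jacobi_energy n * jint a b (horner (y n * y n)).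
Proof. by rewrite /dirichlet mul1r (eigenpoly_energy a1 b1 (ode n)) opprK. Qed.

Lemma dirichlet1_gt0 n : (0 < n)%N -> 0 < dirichlet n 1.
Proof.
move=> n0; rewrite dirichlet1 mulr_gt0// (lt_le_trans _ (jacobi_energy_ge n))//.
by rewrite mulr_gt0 ?ltr0n//; exact: ab2.
Qed.

Lemma cvg_dirichlet Q :
  dirichlet n Q / dirichlet n 1 @[n --> \oo] --> equilibrium_functional Q.
Proof.
have e n : dirichlet n 1 = jint (a + 1) (b + 1) (horner ((y n)^`() * (y n)^`())).
  by rewrite /dirichlet mul1r.
under eq_fun do rewrite e.
pose lam n := - jacobi_energy n + (a + b + 2).
have lamE n : - lam n.+1 = n%:R * (n%:R + (a + b + 3)).
  by rewrite /lam /jacobi_energy -natr1; ring.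
have lam_ge n : (a + b + 3) * n%:R <= - lam n.+1.
  rewrite lamE mulrC ler_wpM2l//.
  by have := ler0n R n; move: ab2; lra.
apply: (@eigen_cvg R (a + 1) (b + 1) (fun n => (y n)^`()) lam) => //.
- by move=> n; exact: (eigenpoly_deriv (ode n)).
- exists 2%N => // -[|n]//= n2; rewrite -oppr_eq0 gt_eqF//.
  apply: lt_le_trans (lam_ge n).
  by rewrite mulr_gt0 ?ltr0n//; move: ab2; lra.
- rewrite -(cvg_shiftS (fun n => (lam n)^-1 : R)).
  have h : (- lam n.+1)^-1 @[n --> \oo] --> (0 : R).
    apply: (@cvg_invr0 _ (a + b + 3)); first by move: ab2; lra.
    exact: nearW.
  have -> : (fun n => (lam n.+1)^-1 : R) = (fun n => - (- lam n.+1)^-1).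
    by apply/funext => n; rewrite invrN opprK.
  by have := cvgN h; rewrite oppr0; apply.
- by exists 1%N => // n /=; rewrite -e; exact: dirichlet1_gt0.
Qed.

Lemma cvg_mass_dirichlet :
  jint a b (horner (y n * y n)) / dirichlet n 1 @[n --> \oo] --> (0 : R).
Proof.
rewrite (_ : (fun n => _) = (fun n => (jacobi_energy n)^-1)).
  exact: cvg_jacobi_energyV.
apply/funext => n; rewrite dirichlet1 invfM mulrCA divff ?mulr1//.
by rewrite gt_eqF.
Qed.

(** Hardy's inequality with a bump of large exponent M: the first term is
    negligible for fixed M, and the second tends to a multiple of the arcsine
    mean of the bump, which is small. *)
Lemma cvg_hardy s k c a' b' : s ^+ 2 = 1 -> 0 < k -> -1 < a' -> -1 < b' ->
  drift a' b' = s *: (c *: (1 - s *: 'X) - (2 * k)%:P) ->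
  (forall f, jint a b f = jint a' b' (fun x => (1 - s * x) * f x)) ->
  jint a' b' (horner (y n * y n)) / dirichlet n 1 @[n --> \oo] --> (0 : R).
Proof.
move=> s2 k0 a'1 b'1 dE shift.
apply/cvgrPdist_lt => e e0.
have [|M Me] := @equilibrium_bump_small R s (k ^+ 2 / 2 * e) s2.
  by rewrite mulr_gt0// divr_gt0// exprn_gt0.
pose C := `|M%:R + c| + k * M%:R / 2.
pose v n := k^-1 * (C * (jint a b (horner (y n * y n)) / dirichlet n 1) +
  k^-1 * (2 * (dirichlet n (bump s M.+1) / dirichlet n 1))).
have vl : v n @[n --> \oo] -->
    k^-1 * (C * 0 + k^-1 * (2 * equilibrium_functional (bump s M.+1))).
  apply: cvgM; first exact: cvg_cst.
  apply: cvgD; (apply: cvgM; first exact: cvg_cst).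
    exact: cvg_mass_dirichlet.
  apply: cvgM; first exact: cvg_cst.
  exact: cvg_dirichlet.
have le : k^-1 * (C * 0 + k^-1 * (2 * equilibrium_functional (bump s M.+1))) < e.
  rewrite mulr0 add0r mulrA -invfM -expr2 mulrC ltr_pdivrMr ?exprn_gt0//.
  move: Me; rewrite -mulrA [_ * e]mulrC.
  move: (equilibrium_functional _) => E; rewrite [k ^+ 2 * _]mulrC; lra.
near=> n.
have n0 : (0 < n)%N by near: n; exact: nbhs_infty_gt.
have U0 := dirichlet1_gt0 n0.
have ve : v n < e by near: n; exact: (cvgr_lt _ vl).
rewrite sub0r normrN ger0_norm; last first.
  rewrite divr_ge0 ?(ltW U0)// jint_ge0// => x _.
  by rewrite hornerM -expr2 sqr_ge0.
apply: le_lt_trans ve; rewrite /v ler_pdivlMl// [k * _]mulrA ler_pdivrMr//.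
have -> : (C * (jint a b (horner (y n * y n)) / dirichlet n 1) +
    k^-1 * (2 * (dirichlet n (bump s M.+1) / dirichlet n 1))) * dirichlet n 1 =
    C * jint a b (horner (y n * y n)) + k^-1 * (2 * dirichlet n (bump s M.+1)).
  by field; rewrite (gt_eqF k0) (gt_eqF U0).
have mE : jint a b (horner (y n * y n)) =
    jint a' b' (horner ((1 - s *: 'X) * (y n * y n))).
  by rewrite shift; apply: eq_jint => x _; rewrite [RHS]hornerM !hornerE.
have dirE : 2 * dirichlet n (bump s M.+1) =
    jint a' b' (horner ((1 - 'X^2) ^+ 2 * bump s M * ((y n)^`() * (y n)^`()))).
  rewrite -jintZ//; last exact: bdd_measurable_poly.
  rewrite jint_shift shift; apply: eq_jint => x _.
  have x2 : 1 - x ^+ 2 = (1 - s * x) * (1 + s * x).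
    transitivity (1 - s ^+ 2 * x ^+ 2); last by ring.
    by rewrite s2 mul1r.
  rewrite !hornerM !horner_bump.
  rewrite (_ : (1 - 'X^2).[x] = 1 - x ^+ 2) ?x2; last by rewrite !hornerE.
  by rewrite [_ ^+ M.+1]exprS; field.
rewrite mE dirE; exact: hardy.
Unshelve. all: by end_near. Qed.

Lemma cvg_hardy_right : 0 < a ->
  jint (a - 1) b (horner (y n * y n)) / dirichlet n 1 @[n --> \oo] --> (0 : R).
Proof.
move=> a0; apply: (@cvg_hardy 1 a (a + b + 1)) => //.
- by rewrite expr1n.
- by move: a0; lra.
- rewrite /drift -!mul_polyC !(polyCN, polyCM, polyC_natr, polyC1, polyCD); ring.
- by move=> f; rewrite -{1}(subrK 1 a) jint_shift_right;
    apply: eq_jint => x _; rewrite mul1r.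
Qed.

Lemma cvg_hardy_left : 0 < b ->
  jint a (b - 1) (horner (y n * y n)) / dirichlet n 1 @[n --> \oo] --> (0 : R).
Proof.
move=> b0; apply: (@cvg_hardy (-1) b (a + b + 1)) => //.
- by rewrite sqrrN expr1n.
- by move: b0; lra.
- rewrite /drift -!mul_polyC !(polyCN, polyCM, polyC_natr, polyC1, polyCD); ring.
- by move=> f; rewrite -{1}(subrK 1 b) jint_shift_left;
    apply: eq_jint => x _; rewrite mulN1r opprK.
Qed.

(** At an endpoint where the exponent is raised by 1 the mass of y^2 only
    decreases, up to a constant; where it is lowered by 1 the bound is Hardy's.
    If both are lowered, 2 = (1 + x) + (1 - x) separates the two
    singularities. *)
Lemma cvg_mass_shifted (e1 e2 : bool) : (e1 -> 0 < a) -> (e2 -> 0 < b) ->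
  jint (a + (-1) ^+ e1) (b + (-1) ^+ e2) (horner (y n * y n)) / dirichlet n 1
    @[n --> \oo] --> (0 : R).
Proof.
move=> h1 h2.
have sq0 n (x : R) : 0 <= (y n * y n).[x] by rewrite hornerM -expr2 sqr_ge0.
have U0 n : 0 <= (dirichlet n 1)^-1.
  by rewrite invr_ge0 /dirichlet jint_ge0// => x _; rewrite mul1r hornerM -expr2 sqr_ge0.
suff [v vcvg ve] : exists2 v : nat -> R, v n / dirichlet n 1 @[n --> \oo] --> (0 : R) &
    forall n, jint (a + (-1) ^+ e1) (b + (-1) ^+ e2) (horner (y n * y n)) <= 2 * v n.
  apply: (@squeeze_cvgr _ _ _ _ (cst 0) (fun n => 2 * (v n / dirichlet n 1))).
  - apply: nearW => n; rewrite mulr_ge0//=; last by apply: jint_ge0 => x _.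
    by rewrite mulrA ler_wpM2r.
  - exact: cvg_cst.
  - rewrite -(mulr0 2); apply: cvgM => //; exact: cvg_cst.
have tY n : bdd_measurable (horner (y n * y n)) by exact: bdd_measurable_poly.
have tL p n : bdd_measurable (fun x => horner p x * (y n * y n).[x]).
  by apply: bdd_measurableM; exact: bdd_measurable_poly.
have t2 n : bdd_measurable (fun x => 2 * (y n * y n).[x]).
  by apply: bdd_measurableM => //; exact: bdd_measurable_cst.
case: e1 e2 h1 h2 => [] [] /= h1 h2; rewrite ?expr0 ?expr1.
- have a10 : -1 < a - 1 by have := h1 isT; lra.
  have b10 : -1 < b - 1 by have := h2 isT; lra.
  exists (fun n => jint (a - 1) b (horner (y n * y n)) +
      jint a (b - 1) (horner (y n * y n))).
    under eq_fun do rewrite mulrDl.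
    rewrite -(addr0 0); apply: cvgD.
      by apply: cvg_hardy_right; exact: h1.
    by apply: cvg_hardy_left; exact: h2.
  move=> n.
  have -> : jint (a - 1) b (horner (y n * y n)) =
      jint (a - 1) (b - 1) (fun x => (1 + 'X).[x] * (y n * y n).[x]).
    rewrite -{1}(subrK 1 b) jint_shift_left.
    by apply: eq_jint => x _; rewrite !hornerE.
  have -> : jint a (b - 1) (horner (y n * y n)) =
      jint (a - 1) (b - 1) (fun x => (1 - 'X).[x] * (y n * y n).[x]).
    rewrite -{1}(subrK 1 a) jint_shift_right.
    by apply: eq_jint => x _; rewrite !hornerE.
  rewrite -jintD// -jintZ//; last exact: bdd_measurableD.
  apply: le_jint => //.
    by apply: bdd_measurableM; [exact: bdd_measurable_cst|exact: bdd_measurableD].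
  move=> x _; have := sq0 n x; move: (y n * y n).[x] => Y Y0.
  by rewrite !hornerE; lra.
- have a10 : -1 < a - 1 by have := h1 isT; lra.
  exists (fun n => jint (a - 1) b (horner (y n * y n))).
    by apply: cvg_hardy_right; exact: h1.
  move=> n; rewrite jint_shift_left -jintZ//; apply: le_jint => //.
    apply: bdd_measurableM => //; apply: (@bdd_measurable_eq_poly _ _ (1 + 'X)) => x.
    by rewrite !hornerE.
  move=> x; rewrite in_itv/= => /andP[x1 x2].
  by rewrite ler_wpM2r//; lra.
- have b10 : -1 < b - 1 by have := h2 isT; lra.
  exists (fun n => jint a (b - 1) (horner (y n * y n))).
    by apply: cvg_hardy_left; exact: h2.
  move=> n; rewrite jint_shift_right -jintZ//; apply: le_jint => //.
    apply: bdd_measurableM => //; apply: (@bdd_measurable_eq_poly _ _ (1 - 'X)) => x.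
    by rewrite !hornerE.
  move=> x; rewrite in_itv/= => /andP[x1 x2].
  by rewrite ler_wpM2r//; lra.
- exists (fun n => jint a b (horner (y n * y n))); first exact: cvg_mass_dirichlet.
  move=> n; rewrite jint_shift -jintZ//; apply: le_jint => //.
    apply: bdd_measurableM => //; apply: (@bdd_measurable_eq_poly _ _ (1 - 'X^2)) => x.
    by rewrite !hornerE.
  move=> x _; rewrite ler_wpM2r//.
  by have := sqr_ge0 x; lra.
Qed.

End asymptotics.

(** * The exceptional polynomials *)

Section exceptional_limit.
Context {R : realType}.
Implicit Types (f g : R -> R) (Q : {poly R}) (n : nat) (x : R).
Variables (a b : R) (y : nat -> {poly R}) (e1 e2 : bool) (w : R -> R).
Hypotheses (a1 : -1 < a) (b1 : -1 < b).
Hypothesis ode : forall n, eigenpoly a b (- jacobi_energy a b n) (y n).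
Hypothesis y0 : forall n, 0 < jint a b (horner (y n * y n)).
Hypotheses (a1' : -1 < a + (-1) ^+ e1) (b1' : -1 < b + (-1) ^+ e2).
Hypotheses (ae1 : e1 -> 0 < a) (be2 : e2 -> 0 < b).
Hypothesis tw : bdd_measurable w.

Local Notation a' := (a + (-1) ^+ e1).
Local Notation b' := (b + (-1) ^+ e2).

Definition endpoint_poly : {poly R} := (1 - 'X) ^+ e1 * (1 + 'X) ^+ e2.

(** When b = endpoint_poly * bt and w = bw / bt, this is the exceptional
    polynomial divided by bt, so that its square times the Jacobi weight of
    exponents a + (-1) ^+ e1 and b + (-1) ^+ e2 is the exceptional density. *)
Definition xstate n x : R :=
  endpoint_poly.[x] * (y n)^`().[x] - w x * (y n).[x].

Definition xint n f : R := jint a' b' (fun x => f x * xstate n x ^+ 2).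

Lemma jint_endpoint f :
  jint a' b' (fun x => endpoint_poly.[x] ^+ 2 * f x) = jint (a + 1) (b + 1) f.
Proof.
rewrite /endpoint_poly.
have -> : jint (a + 1) (b + 1) f =
    jint a' (b + 1) (fun x => ((1 - 'X) ^+ e1).[x] ^+ 2 * f x).
  case: (e1); last by apply: eq_jint => x _; rewrite expr0 !hornerE expr1n mul1r.
  rewrite expr1 -[a + 1](_ : a - 1 + 1 + 1 = _); last by ring.
  rewrite !jint_shift_right; apply: eq_jint => x _.
  by rewrite expr1 !hornerE /=; ring.
case: (e2); last first.
  by apply: eq_jint => x _; rewrite [_ ^+ false]expr0 mulr1.
rewrite expr1 -[b + 1](_ : b - 1 + 1 + 1 = _); last by ring.
rewrite !jint_shift_left; apply: eq_jint => x _.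
by rewrite expr1 hornerM [(1 + 'X).[x]](_ : _ = 1 + x) ?hornerE//=; ring.
Qed.

Let U n := dirichlet a b y n 1.
Let m n := jint a' b' (horner (y n * y n)).

Lemma bdd_measurable_xstate n : bdd_measurable (xstate n).
Proof.
apply: bdd_measurableD; first by apply: bdd_measurableM; exact: bdd_measurable_poly.
by apply: bdd_measurableN; apply: bdd_measurableM => //; exact: bdd_measurable_poly.
Qed.

Lemma bdd_measurable_xint n f : bdd_measurable f -> bdd_measurable (fun x => f x * xstate n x ^+ 2).
Proof.
by move=> tf; apply: bdd_measurableM => //; apply: bdd_measurableM; exact: bdd_measurable_xstate.
Qed.

Let dirE n Q : dirichlet a b y n Q =
  jint a' b' (fun x => Q.[x] * (endpoint_poly.[x] * (y n)^`().[x]) ^+ 2).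
Proof.
rewrite /dirichlet -jint_endpoint; apply: eq_jint => x _.
by rewrite !hornerM exprMn; ring.
Qed.

(** Expanding (u - v)^2 and bounding 2 u v by d u^2 + v^2 / d: the parameter d
    is free, and the error consists of a small multiple of the main term and a
    large multiple of the negligible one. *)
Lemma xint_approx Q : exists C, forall (d : R) n, 0 < d ->
  `|xint n (horner Q) - dirichlet a b y n Q| <=
  C * d * U n + C * (1 + d^-1) * m n.
Proof.
have [_ [K QK]] := bdd_measurable_poly Q.
have [_ [L wL]] := tw.
exists (`|K| * (1 + L ^+ 2)) => d n d0.
have tc : bdd_measurable (fun x => endpoint_poly.[x] * (y n)^`().[x]).
  by apply: bdd_measurableM; exact: bdd_measurable_poly.
have tc2 P : bdd_measurable (fun x => P.[x] * (endpoint_poly.[x] * (y n)^`().[x]) ^+ 2).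
  by apply: bdd_measurableM; [exact: bdd_measurable_poly|exact: bdd_measurableM].
set C := `|K| * (1 + L ^+ 2).
rewrite /U /m dirE dirE -!jintZ//; try exact: bdd_measurable_poly.
rewrite -[- jint _ _ _]mulN1r -jintZ// -jintD//; last 2 first.
- by apply: bdd_measurable_xint; exact: bdd_measurable_poly.
- by apply: bdd_measurableM => //; exact: bdd_measurable_cst.
rewrite -jintD//; last 2 first.
- by apply: bdd_measurableM => //; exact: bdd_measurable_cst.
- by apply: bdd_measurableM;
  [exact: bdd_measurable_cst|exact: bdd_measurable_poly].
apply: ler_norm_jint => //.
- apply: bdd_measurableD; first by apply: bdd_measurable_xint; exact: bdd_measurable_poly.
  by apply: bdd_measurableM => //; exact: bdd_measurable_cst.
- apply: bdd_measurableD; apply: bdd_measurableM => //; try exact: bdd_measurable_cst.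
  exact: bdd_measurable_poly.
move=> x x1; rewrite /= -[1 : {poly R}]/(1%:P) hornerC mul1r.
have qx := le_trans (QK _ x1) (ler_norm K).
rewrite mulN1r -mulrBr normrM [(y n * y n).[x]]hornerM.
rewrite /xstate; set c := endpoint_poly.[x] * _; set z := (y n).[x].
have wx : w x ^+ 2 <= L ^+ 2.
  have := wL _ x1; rewrite ler_norml => /andP[w1 w2].
  by rewrite -subr_ge0 subr_sqr mulr_ge0//; lra.
have amgm : `|(c - w x * z) ^+ 2 - c ^+ 2| <=
    d * c ^+ 2 + (1 + d^-1) * (w x * z) ^+ 2.
  set v := w x * z.
  have dp : 0 < d^-1 by rewrite invr_gt0.
  have h1 : 0 <= d^-1 * (d * c - v) ^+ 2 by rewrite mulr_ge0 ?sqr_ge0 ?ltW.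
  have h2 : 0 <= d^-1 * (d * c + v) ^+ 2 by rewrite mulr_ge0 ?sqr_ge0 ?ltW.
  have e1' : d^-1 * (d * c - v) ^+ 2 = d * c ^+ 2 - 2 * c * v + d^-1 * v ^+ 2.
    by field; rewrite gt_eqF.
  have e2' : d^-1 * (d * c + v) ^+ 2 = d * c ^+ 2 + 2 * c * v + d^-1 * v ^+ 2.
    by field; rewrite gt_eqF.
  rewrite e1' in h1; rewrite e2' in h2.
  have := sqr_ge0 v.
  rewrite ler_norml; move: h1 h2; set i := d^-1 * v ^+ 2 => h1 h2 h3.
  have -> : (1 + d^-1) * v ^+ 2 = v ^+ 2 + i by rewrite /i; ring.
  by apply/andP; split; lra.
apply: le_trans (ler_pM _ _ qx amgm) _ => //.
have wz : (w x * z) ^+ 2 <= L ^+ 2 * z ^+ 2.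
  by rewrite exprMn ler_wpM2r ?sqr_ge0.
have dp : 0 < d^-1 by rewrite invr_gt0.
have dc : 0 <= d * c ^+ 2 by rewrite mulr_ge0 ?sqr_ge0 ?ltW.
have -> : C * d * c ^+ 2 + C * (1 + d^-1) * (z * z) =
    `|K| * ((1 + L ^+ 2) * (d * c ^+ 2) + (1 + d^-1) * ((1 + L ^+ 2) * z ^+ 2)).
  by rewrite /C; ring.
rewrite ler_wpM2l// lerD//.
  by rewrite ler_peMl//; have := sqr_ge0 L; lra.
rewrite ler_wpM2l//; first lra.
by apply: le_trans wz _; rewrite ler_wpM2r ?sqr_ge0//; lra.
Qed.

Lemma cvg_xint_dirichlet Q :
  xint n (horner Q) / U n @[n --> \oo] --> equilibrium_functional Q.
Proof.
suff h : xint n (horner Q) / U n - dirichlet a b y n Q / U n @[n --> \oo] --> (0 : R).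
  have -> : (fun n => xint n (horner Q) / U n) = (fun n =>
      (xint n (horner Q) / U n - dirichlet a b y n Q / U n) +
      dirichlet a b y n Q / U n) by apply/funext => n; rewrite subrK.
  rewrite -[equilibrium_functional Q]add0r; apply: cvgD => //.
  exact: cvg_dirichlet.
have [C le] := xint_approx Q.
apply/cvgrPdist_lt => e ep.
(* Small enough for the main error term C d to be at most e / 2. *)
pose d := e / 2 / (`|C| + 1).
have C1 : 0 < `|C| + 1 by rewrite ltr_wpDl.
have d0 : 0 < d by rewrite /d !divr_gt0.
have Cd : C * d <= e / 2.
  apply: (@le_trans _ _ ((`|C| + 1) * d)).
    by rewrite ler_wpM2r ?ltW//; have := ler_norm C; lra.
  by rewrite /d mulrC divfK// gt_eqF.
have mU0 : C * (1 + d^-1) * (m n / U n) @[n --> \oo] --> C * (1 + d^-1) * 0.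
  by apply: cvgM; [exact: cvg_cst|exact: cvg_mass_shifted].
have /cvgrPdist_lt /(_ (e / 2)) := mU0.
rewrite divr_gt0// => /(_ isT) mU.
near=> n.
have n0 : (0 < n)%N by near: n; exact: nbhs_infty_gt.
have U0 : 0 < U n by exact: dirichlet1_gt0.
have : `|C * (1 + d^-1) * 0 - C * (1 + d^-1) * (m n / U n)| < e / 2.
  by near: n; exact: mU.
rewrite mulr0 !sub0r !normrN => mn.
rewrite -mulrBl normrM normfV (gtr0_norm U0) ltr_pdivrMr//.
apply: le_lt_trans (le d n d0) _.
rewrite -ltr_pdivrMr// mulrDl mulfK ?gt_eqF//.
have := le_lt_trans (ler_norm _) mn; rewrite mulrA.
by lra.
Unshelve. all: by end_near. Qed.

Lemma cvg_xint_poly Q :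
  xint n (horner Q) / xint n (horner 1) @[n --> \oo] --> equilibrium_functional Q.
Proof.
have h1 : (xint n (horner 1) / U n)^-1 @[n --> \oo] --> (1 : R).
  rewrite -[X in _ --> X]invr1; apply: cvgV; first exact: oner_neq0.
  by have := @cvg_xint_dirichlet 1; rewrite equilibrium_functional1.
have h2 := cvgM (@cvg_xint_dirichlet Q) h1; rewrite mulr1 in h2.
apply: (@cvg_trans _ ((fun n => xint n (horner Q) / U n *
  (xint n (horner 1) / U n)^-1) @ \oo)); last exact: h2.
apply: near_eq_cvg; near=> n.
have n0 : (0 < n)%N by near: n; exact: nbhs_infty_gt.
have U0 : 0 < U n by exact: dirichlet1_gt0.
by rewrite /= invf_div mulrA divfK// gt_eqF.
Unshelve. all: by end_near. Qed.

End exceptional_limit.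

(** * Weierstrass approximation *)

Section weierstrass.
Context {R : realType}.
Implicit Types (f : R -> R) (h : nat -> R) (t x y : R) (n : nat).

(** The Bernstein polynomial: at t it is the expectation of h(K) for K binomial
    with parameters n and t. Conditioning on the first trial makes the
    induction below immediate, without any identity between binomial
    coefficients. *)
Fixpoint bernstein n h : {poly R} :=
  if n is n'.+1 then
    'X * bernstein n' (fun k => h k.+1) + (1 - 'X) * bernstein n' h
  else (h 0%N)%:P.

(** The bracket is the expectation of (K - c)^2 for K binomial. The centre c is
    arbitrary because conditioning on a success shifts it by 1. *)
Lemma bernstein_approx n h (t h0 A B c : R) : 0 <= t <= 1 ->
  (forall k, (k <= n)%N -> `|h k - h0| <= A + B * (k%:R - c) ^+ 2) ->
  `|(bernstein n h).[t] - h0| <=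
  A + B * (n%:R * t * (1 - t) + (n%:R * t - c) ^+ 2).
Proof.
move=> t01; have /andP[t0 t1] := t01; elim: n h c => [|n ih] h c hle.
  rewrite /= hornerC !mul0r add0r; exact: hle.
have ih1 := ih (fun k => h k.+1) (c - 1).
have ih0 := ih h c.
rewrite [bernstein _ _]/= !hornerE.
set E1 := (bernstein n (fun k => h k.+1)).[t] in ih1 *.
set E0 := (bernstein n h).[t] in ih0 *.
have {}ih0 : `|E0 - h0| <= A + B * (n%:R * t * (1 - t) + (n%:R * t - c) ^+ 2).
  by apply: ih0 => k kn; apply: hle; rewrite ltnW.
have {}ih1 : `|E1 - h0| <=
    A + B * (n%:R * t * (1 - t) + (n%:R * t - (c - 1)) ^+ 2).
  apply: ih1 => k kn; rewrite (_ : k%:R - (c - 1) = k.+1%:R - c).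
    exact: hle.
  by rewrite -(natr1 k); ring.
have -> : t * E1 + (1 - t) * E0 - h0 = t * (E1 - h0) + (1 - t) * (E0 - h0).
  by ring.
apply: le_trans (ler_normD _ _) _; rewrite !normrM.
have t1' : 0 <= 1 - t by lra.
rewrite (ger0_norm t0) (ger0_norm t1').
apply: le_trans (lerD (ler_wpM2l t0 ih1) (ler_wpM2l t1' ih0)) _.
rewrite le_eqVlt; apply/orP; left; apply/eqP.
by rewrite -(natr1 n); ring.
Qed.

(** Uniform continuity in the form used with Chebyshev's inequality: for points
    that are not close, the quadratic term dominates the oscillation of f. *)
Lemma continuous_quadratic_modulus f (e : R) :
  {within `[-1, 1], continuous f} -> 0 < e ->
  exists n, forall x y, x \in `[-1, 1] -> y \in `[-1, 1] ->
    `|f x - f y| <= e + n%:R * (x - y) ^+ 2.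
Proof.
move=> fc e0.
have fc' : {within `[-1, 1], continuous (fun x => `|f x|)}.
  move=> y; apply: continuous_comp; [exact: fc|exact: norm_continuous].
have [|m _ mM] := EVT_max _ fc'; first lra.
have {mM} [M M0 fM] : exists2 M, 0 <= M & forall x, x \in `[-1, 1] -> `|f x| <= M.
  by exists `|f m|.
have /compact_near_coveringP cover := @segment_compact R (-1) 1.
have [] := cover nat \oo (fun n x => forall y, x \in `[-1, 1] -> y \in `[-1, 1] ->
    `|f x - f y| <= e + n%:R * (x - y) ^+ 2).
  move=> x0 x01.
  have /subspace_continuousP /(_ _ x01) /cvgrPdist_lt /(_ (e / 2)) := fc.
  rewrite divr_gt0// => /(_ isT); rewrite near_withinE.
  move=> /nbhs_ballP [d /= d0 dx].
  (* Beyond distance d / 2 the oscillation 2 M is at most N (d / 2)^2. *)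
  pose N := Num.truncn (2 * M / (d / 2) ^+ 2).
  exists (ball x0 (d / 2), [set n | (N < n)%N]).
    split => /=; first by apply: nbhsx_ballx; rewrite divr_gt0.
    exact: nbhs_infty_gt.
  move=> [x n] [/= xd Nn] y x1 y1.
  have xd' : ball x0 d x by apply: le_ball xd; lra.
  have fx := dx _ xd' x1.
  have [yd|yd] := ltP `|x - y| (d / 2).
    have yd' : ball x0 d y.
      rewrite /ball /= (_ : x0 - y = (x0 - x) + (x - y)); last by ring.
      rewrite (le_lt_trans (ler_normD _ _))// (splitr d) ltrD//.
    have fy := dx _ yd' y1.
    have -> : f x - f y = (f x0 - f y) - (f x0 - f x) by ring.
    apply: le_trans (ler_normB _ _) _.
    have : 0 <= n%:R * (x - y) ^+ 2 by rewrite mulr_ge0 ?sqr_ge0.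
    by move: fx fy; lra.
  apply: le_trans (ler_normB _ _) _.
  have nM : 2 * M / (d / 2) ^+ 2 < n%:R.
    by apply: lt_le_trans (truncnS_gt _) _; rewrite ler_nat.
  have d2 : 0 < (d / 2) ^+ 2 by rewrite exprn_gt0 ?divr_gt0.
  move: nM; rewrite ltr_pdivrMr// => nM.
  have xy2 : (d / 2) ^+ 2 <= (x - y) ^+ 2.
    by rewrite -[leRHS]real_normK ?num_real// ler_pXn2r// ?nnegrE ?divr_ge0 ?ltW.
  have := ler_wpM2l (ler0n R n) xy2.
  by have := fM _ x1; have := fM _ y1; lra.
move=> n _ /(_ n) /= h; exists n => x y x1 y1.
by apply: h.
Qed.

Theorem weierstrass_approximation f (e : R) :
  {within `[-1, 1], continuous f} -> 0 < e ->
  exists Q : {poly R}, forall x, x \in `[-1, 1] -> `|f x - Q.[x]| <= e.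
Proof.
move=> fc e0.
have [|B fB] := continuous_quadratic_modulus fc (_ : 0 < e / 2).
  by rewrite divr_gt0.
have [n n0 nB] : exists2 n, 0 < n%:R :> R & 2 * B%:R / e < n%:R.
  by exists (Num.truncn (2 * B%:R / e)).+1; [rewrite ltr0n|exact: truncnS_gt].
exists (bernstein n (fun k => f (2 * k%:R / n%:R - 1)) \Po (2^-1 *: (1 + 'X))).
move=> x x1; rewrite horner_comp !hornerE distrC.
set t := 2^-1 * (1 + x).
have t01 : 0 <= t <= 1.
  by move: x1; rewrite in_itv/= /t => /andP[x1 x2]; apply/andP; split; lra.
apply: le_trans (@bernstein_approx _ _ _ (f x) (e / 2) (B%:R * 4 / n%:R ^+ 2)
    (n%:R * t) t01 _) _.
  move=> k kn.
  have k1 : 2 * k%:R / n%:R - 1 \in `[(-1 : R), 1].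
    have k0 := ler0n R k; have kn' : k%:R <= n%:R :> R by rewrite ler_nat.
    rewrite in_itv/=; apply/andP; split.
      by rewrite lerBrDr addNr divr_ge0 ?mulr_ge0// ltW.
    by rewrite lerBlDr ler_pdivrMr//; lra.
  apply: le_trans (fB _ _ k1 x1) _; rewrite lerD2l.
  rewrite le_eqVlt; apply/orP; left; apply/eqP.
  by rewrite /t; field; rewrite gt_eqF.
rewrite subrr expr0n/= addr0.
have -> : B%:R * 4 / n%:R ^+ 2 * (n%:R * t * (1 - t)) =
  (B%:R / n%:R) * (4 * (t * (1 - t))) by field; rewrite gt_eqF.
have h1 : B%:R / n%:R <= e / 2.
  move: nB; rewrite !ltr_pdivrMr// => nB.
  by rewrite ler_pdivrMr//; lra.
have h2 : 0 <= B%:R / n%:R :> R by rewrite divr_ge0.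
have h3 : 4 * (t * (1 - t)) <= 1 by have := sqr_ge0 (1 - 2 * t); lra.
have h4 := ler_wpM2l h2 h3.
by move: h4; rewrite mulr1; lra.
Qed.

End weierstrass.

(** * Integrals against a density *)

Section density_integral.
Context {R : realType}.
Local Notation mu := (@lebesgue_measure R).
Variables (D : set R) (g : R -> R).
Hypotheses (mD : measurable D) (g0 : forall x, D x -> 0 <= g x)
  (mg : measurable_fun D g).
Local Notation nu := (density_measure mD g0 mg).

Import HBNNSimple.

Let density_indic (r : R) (A : set (measurableTypeR R)) : measurable A -> 0 <= r ->
  (\int[nu]_(x in D) (r * \1_A x)%:E =
   \int[mu]_(x in D) ((r * \1_A x)%:E * (g x)%:E))%E.
Proof.
move=> mA r0.
under eq_integral do rewrite EFinM.
rewrite ge0_integralZl//; last exact/measurable_EFinP.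
rewrite integral_indic//= /density_measure.
under [RHS]eq_integral do rewrite EFinM -muleA.
rewrite [RHS]ge0_integralZl//; last 2 first.
- apply: emeasurable_funM; first exact/measurable_EFinP.
  exact/measurable_EFinP.
- by move=> x Dx; rewrite mule_ge0// lee_fin g0.
congr (_ * _)%E.
rewrite -setIA setIid setIC integral_mkcondr.
apply: eq_integral => x _; rewrite patchE indicE.
by case: ifPn => _; rewrite ?mul1e ?mul0e.
Qed.

Let density_nnsfun (f : {nnsfun (measurableTypeR R) >-> R}) :
  (\int[nu]_(x in D) (f x)%:E = \int[mu]_(x in D) ((f x)%:E * (g x)%:E))%E.
Proof.
under [LHS]eq_integral do rewrite fimfunE -fsumEFin//.
rewrite [LHS]ge0_integral_fsum//; last 2 first.
  - by move=> r; exact/measurable_EFinP/measurableT_comp.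
  - by move=> n x _; rewrite EFinM nnfun_muleindic_ge0.
under [RHS]eq_integral.
  move=> x xD; rewrite fimfunE -fsumEFin// ge0_mule_fsuml; last first.
    by move=> r; rewrite EFinM nnfun_muleindic_ge0.
  over.
rewrite [RHS]ge0_integral_fsum//; last 2 first.
  - move=> r; apply: emeasurable_funM; last exact/measurable_EFinP.
    by apply/measurable_EFinP; do 2 apply/measurableT_comp => //.
  - move=> n x Dx; rewrite mule_ge0//; last by rewrite lee_fin g0.
    by rewrite EFinM nnfun_muleindic_ge0.
apply: eq_fsbigr => r; rewrite inE => -[t _ <-].
exact: density_indic.
Qed.

Lemma ge0_integral_density (f : R -> \bar R) : measurable_fun D f ->
  (forall x, D x -> 0 <= f x)%E ->
  (\int[nu]_(x in D) f x = \int[mu]_(x in D) (f x * (g x)%:E))%E.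
Proof.
move=> mf f0.
have mD' : measurable (D : set (measurableTypeR R)) by exact: mD.
have mf' : measurable_fun (D : set (measurableTypeR R)) f by exact: mf.
pose f_ := nnsfun_approx mD' mf'.
transitivity (lim (\int[nu]_(x in D) (f_ n x)%:E @[n --> \oo])%E).
  rewrite -monotone_convergence//=.
  - apply: eq_integral => ? /[!inE] xD; apply/esym/cvg_lim => //=.
    exact: cvg_nnsfun_approx.
  - by move=> n; exact/measurable_EFinP/measurable_funTS.
  - by move=> n ? _; rewrite lee_fin.
  - by move=> ? _ ? ? mn; rewrite lee_fin; exact/lefP/nd_nnsfun_approx.
under eq_fun do rewrite density_nnsfun.
rewrite -monotone_convergence//=.
- apply: eq_integral => x /[!inE] xD; apply/cvg_lim => //=.
  apply: cvgeZr => //; exact: cvg_nnsfun_approx.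
- move=> n; apply: emeasurable_funM; last exact/measurable_EFinP.
  by apply/measurable_EFinP; apply: measurable_funTS.
- by move=> n x Dx; rewrite mule_ge0// lee_fin// g0.
- move=> x Dx m n mn; rewrite lee_wpmul2r ?lee_fin ?g0//.
  exact/lefP/nd_nnsfun_approx.
Qed.

Lemma Rintegral_density (f : R -> R) : measurable_fun D f ->
  \int[nu]_(x in D) f x = \int[mu]_(x in D) (f x * g x).
Proof.
move=> mf; rewrite /Rintegral; congr fine.
rewrite [LHS]integralE [RHS]integralE.
have mf' : measurable_fun D (EFin \o f) by exact/measurable_EFinP.
rewrite !ge0_integral_density//; last 2 first.
- exact: measurable_funeneg.
- exact: measurable_funepos.
congr (_ - _)%E; apply: eq_integral => x /[!inE] xD.
  by rewrite !funeposE muleC maxe_pMr ?lee_fin ?g0// mule0 muleC.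
by rewrite !funenegE muleC maxe_pMr ?lee_fin ?g0// mule0 muleN muleC.
Qed.

End density_integral.

(** * From polynomials to continuous functions *)

Section continuous_test_functions.
Context {R : realType}.
Local Notation mu := (@lebesgue_measure R).
Implicit Types (a b : R) (f g : R -> R).

Lemma bdd_measurable_continuous f : {within `[-1, 1], continuous f} -> bdd_measurable f.
Proof.
move=> fc; split.
  have mf : measurable_fun (`[-1, 1]%classic : set R) f.
    exact: subspace_continuous_measurable_fun.
  apply: measurable_funS mf => //.
  by move=> x; exact: subset_itv_oo_cc.
have fc' : {within `[-1, 1], continuous (fun x => `|f x|)}.
  move=> y; apply: continuous_comp; [exact: fc|exact: norm_continuous].
have [|m _ mP] := EVT_max _ fc'; first lra.
by exists `|f m| => x /subset_itv_oo_cc; exact: mP.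
Qed.

Lemma ler_dist_jint a b f g u : -1 < a -> -1 < b ->
  bdd_measurable f -> bdd_measurable g -> bdd_measurable u ->
  (forall x : R, x \in `]-1, 1[ -> `|f x - g x| <= u x) ->
  `|jint a b f - jint a b g| <= jint a b u.
Proof.
move=> a1 b1 tf tg tu fg.
have -> : jint a b f - jint a b g = jint a b (fun x => f x + (-1) * g x).
  by rewrite jintD ?jintZ ?mulN1r//; apply: bdd_measurableM => //; exact: bdd_measurable_cst.
apply: ler_norm_jint => //.
  by apply: bdd_measurableD => //; apply: bdd_measurableM => //; exact: bdd_measurable_cst.
by move=> x x1; rewrite mulN1r; exact: fg.
Qed.

Lemma jint_sum a b n (F : nat -> R -> R) : -1 < a -> -1 < b ->
  (forall k, bdd_measurable (F k)) ->
  bdd_measurable (fun x => \sum_(k < n) F k x) /\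
  jint a b (fun x => \sum_(k < n) F k x) = \sum_(k < n) jint a b (F k).
Proof.
move=> a1 b1 tF; elim: n => [|n [tn ih]].
  have e : (fun x : R => \sum_(k < 0) F k x) = (fun=> 0 * 0).
    by apply/funext => x; rewrite big_ord0 mul0r.
  rewrite e big_ord0; split; first exact: bdd_measurable_cst.
  by rewrite jintZ ?mul0r//; exact: bdd_measurable_cst.
have e : (fun x : R => \sum_(k < n.+1) F k x) =
    (fun x => \sum_(k < n) F k x + F n x).
  by apply/funext => x; rewrite big_ord_recr.
rewrite e big_ord_recr /=; split; first exact: bdd_measurableD.
by rewrite jintD// ih.
Qed.

Lemma Rintegral_segment f : measurable_fun (`[-1, 1]%classic : set R) f ->
  \int[mu]_(x in `[-1, 1]) f x = \int[mu]_(x in `]-1, 1[) f x.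
Proof.
move=> mf; rewrite /Rintegral; congr fine.
apply: integral_itv_bndoo; apply/measurable_EFinP.
apply: measurable_funS mf => //.
by move=> x; exact: subset_itv_oo_cc.
Qed.

End continuous_test_functions.

Section exceptional_limit_continuous.
Context {R : realType}.
Variables (a b : R) (y : nat -> {poly R}) (e1 e2 : bool) (w : R -> R).
Hypotheses (a1 : -1 < a) (b1 : -1 < b).
Hypothesis ode : forall n, eigenpoly a b (- jacobi_energy a b n) (y n).
Hypothesis y0 : forall n, 0 < jint a b (horner (y n * y n)).
Hypotheses (a1' : -1 < a + (-1) ^+ e1) (b1' : -1 < b + (-1) ^+ e2).
Hypotheses (ae1 : e1 -> 0 < a) (be2 : e2 -> 0 < b).
Hypothesis tw : bdd_measurable w.

(** Both sides are positive functionals that give mass at most 1 to the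
    constant 1, so a uniform approximation of f by polynomials carries the
    limit over. *)
Lemma cvg_xint_continuous (f : R -> R) : {within `[-1, 1], continuous f} ->
  xint a b y e1 e2 w n f / xint a b y e1 e2 w n (horner 1)
    @[n --> \oo] --> pi^-1 * jint (- 2^-1) (- 2^-1) f.
Proof.
move=> fc; have tf := bdd_measurable_continuous fc.
apply/cvgrPdist_lt => e ep.
have e4 : 0 < e / 4 by rewrite divr_gt0.
have [Q fQ] := weierstrass_approximation fc e4.
have := @cvg_xint_poly R a b y e1 e2 w a1 b1 ode y0 a1' b1' ae1 be2 tw Q.
move=> /cvgrPdist_lt /(_ _ e4) hQ.
have fQo x : x \in `]-1, 1[ -> `|f x - Q.[x]| <= e / 4.
  by move=> /subset_itv_oo_cc; exact: fQ.
have tQ := bdd_measurable_poly Q.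
have h12 : -1 < - 2^-1 :> R by lra.
have pi0 : 0 < (pi : R) by exact: pi_gt0.
have d1 : `|pi^-1 * jint (- 2^-1) (- 2^-1) f - equilibrium_functional Q| <= e / 4.
  have ipi : 0 <= (pi : R)^-1 by rewrite invr_ge0 ltW.
  rewrite /equilibrium_functional -mulrBr normrM (ger0_norm ipi).
  have := equilibrium_functional1 (R := R); rewrite /equilibrium_functional => h1.
  apply: (@le_trans _ _ (pi^-1 * jint (- 2^-1) (- 2^-1) (horner (e / 4)%:P))).
    rewrite ler_wpM2l ?invr_ge0 ?(ltW pi0)//.
    apply: ler_dist_jint => //; first exact: bdd_measurable_poly.
    by move=> x x1; rewrite hornerC; exact: fQo.
  by rewrite -alg_polyC jint_polyZ// mulrCA h1 mulr1.
have d2 n : `|xint a b y e1 e2 w n f / xint a b y e1 e2 w n (horner 1) -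
    xint a b y e1 e2 w n (horner Q) / xint a b y e1 e2 w n (horner 1)| <= e / 4.
  have X0 : 0 <= xint a b y e1 e2 w n (horner 1).
    by apply: jint_ge0 => x _; rewrite -[1 : {poly R}]/(1%:P) hornerC mul1r sqr_ge0.
  rewrite -mulrBl normrM normfV (ger0_norm X0).
  have [->|Xn0] := eqVneq (xint a b y e1 e2 w n (horner 1)) 0.
    by rewrite invr0 mulr0 ltW.
  rewrite ler_pdivrMr; last by rewrite lt_def Xn0.
  rewrite /xint -jintZ//; last by apply: bdd_measurable_xint => //; exact: bdd_measurable_poly.
  apply: ler_dist_jint => //; try by apply: bdd_measurable_xint => //.
    apply: bdd_measurableM; first exact: bdd_measurable_cst.
    by apply: bdd_measurable_xint => //; exact: bdd_measurable_poly.
  move=> x x1; rewrite -mulrBl normrM (ger0_norm (sqr_ge0 _)).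
  rewrite -[1 : {poly R}]/(1%:P) hornerC mul1r.
  by rewrite ler_wpM2r ?sqr_ge0// fQo.
near=> n.
have : `|equilibrium_functional Q -
    xint a b y e1 e2 w n (horner Q) / xint a b y e1 e2 w n (horner 1)| < e / 4.
  by near: n; exact: hQ.
have := d1; have := d2 n.
move: (xint _ _ _ _ _ _ _ f / _) (xint _ _ _ _ _ _ _ (horner Q) / _) => A B.
move: (equilibrium_functional Q) (pi^-1 * _) => C D.
rewrite !ltr_norml !ler_norml => /andP[? ?] /andP[? ?] /andP[? ?].
by apply/andP; split; lra.
Unshelve. all: by end_near. Qed.

End exceptional_limit_continuous.

(** * Weak-star convergence *)

Section measures_as_functionals.
Context {R : realType}.
Local Notation mu := (@lebesgue_measure R).

Lemma equilibrium_measureE (f : R -> R) : {within `[-1, 1], continuous f} ->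
  \int[equilibrium_measure]_(x in `[-1, 1]) f x =
  pi^-1 * jint (- 2^-1) (- 2^-1) f.
Proof.
move=> fc; have tf := bdd_measurable_continuous fc.
have mf : measurable_fun (`[-1, 1]%classic : set R) f.
  exact: subspace_continuous_measurable_fun.
rewrite /equilibrium_measure Rintegral_density// Rintegral_segment; last first.
  by apply: measurable_funM => //; exact: measurable_equilibrium_density.
rewrite -jintZ//; [|lra|lra].
apply: eq_Rintegral => x; rewrite inE => x1.
by rewrite equilibrium_densityE//; ring.
Qed.

Variables (alpha beta : R) (b bw bt : {poly R}) (e1 e2 : bool).
Hypothesis hbt : b = (1 - 'X) ^+ e1 * (1 + 'X) ^+ e2 * bt.
Hypothesis hbt0 : forall x : R, x \in `[-1, 1] -> 0 < bt.[x].
Hypotheses (a1' : -1 < alpha + (-1) ^+ e1) (b1' : -1 < beta + (-1) ^+ e2).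

Local Notation y := (ortho_jacobi alpha beta).
Local Notation w := (fun x => bw.[x] / bt.[x]).
Local Notation X n := (xint alpha beta y e1 e2 w n).

Lemma bdd_measurable_quotient : bdd_measurable w.
Proof.
apply: bdd_measurableM; first exact: bdd_measurable_poly.
apply: bdd_measurable_continuous; apply: continuous_in_subspaceT => x.
rewrite inE => x1; apply: cvgV; first by rewrite gt_eqF// hbt0.
exact: continuous_horner.
Qed.

(** The factor bt of the exceptional polynomial cancels the denominator of the
    weight. *)
Lemma xjacobi_sqr_weight n (x : R) : x \in `]-1, 1[ ->
  (xjacobi alpha beta b bw n).[x] ^+ 2 * xweight alpha beta e1 e2 bt x =
  xstate y e1 e2 w n x ^+ 2 *
    jacobi_weight (alpha + (-1) ^+ e1) (beta + (-1) ^+ e2) x.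
Proof.
move=> x1; have bt0 : bt.[x] != 0.
  by rewrite gt_eqF// hbt0// subset_itv_oo_cc.
have -> : (xjacobi alpha beta b bw n).[x] = bt.[x] * xstate y e1 e2 w n x.
  rewrite /xjacobi /xstate /endpoint_poly hbt hornerD hornerN !hornerM.
  by field.
rewrite /xweight; move: (jacobi_weight _ _ x) (xstate _ _ _ _ _ _) => J z.
by field.
Qed.

Lemma xnorm_sqr n : xnorm alpha beta b bw e1 e2 bt n ^+ 2 = X n (horner 1).
Proof.
rewrite sqr_sqrtr; last first.
  by apply: Rintegral_ge0 => x _; rewrite mulr_ge0 ?sqr_ge0 ?xweight_ge0.
apply: eq_Rintegral => x; rewrite inE => x1.
by rewrite xjacobi_sqr_weight// -[1 : {poly R}]/(1%:P) hornerC mul1r.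
Qed.

Lemma xjacobi_measureE n (f : R -> R) : {within `[-1, 1], continuous f} ->
  \int[xjacobi_measure alpha beta b bw e1 e2 bt n]_(x in `[-1, 1]) f x =
  n%:R^-1 * \sum_(k < n) (X k f / X k (horner 1)).
Proof.
move=> fc; have tf := bdd_measurable_continuous fc.
have tX k : bdd_measurable (fun x => f x * xstate y e1 e2 w k x ^+ 2).
  by apply: bdd_measurable_xint => //; exact: bdd_measurable_quotient.
have mf : measurable_fun (`[-1, 1]%classic : set R) f.
  exact: subspace_continuous_measurable_fun.
rewrite /xjacobi_measure Rintegral_density// Rintegral_segment; last first.
  by apply: measurable_funM => //; exact: measurable_xjacobi_density.
have tF k : bdd_measurable (fun x =>
    (X k (horner 1))^-1 * (f x * xstate y e1 e2 w k x ^+ 2)).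
  by apply: bdd_measurableM => //; exact: bdd_measurable_cst.
have [tS jS] := jint_sum n a1' b1' tF.
have -> : \sum_(k < n) (X k f / X k (horner 1)) =
    \sum_(k < n) jint (alpha + (-1) ^+ e1) (beta + (-1) ^+ e2)
      (fun x => (X k (horner 1))^-1 * (f x * xstate y e1 e2 w k x ^+ 2)).
  by apply: eq_bigr => k _; rewrite jintZ// mulrC.
rewrite -jS -jintZ//; apply: eq_Rintegral => x; rewrite inE => x1.
rewrite /xjacobi_density mulrCA -!mulrA; congr (_ * _).
rewrite mulr_sumr mulr_suml; apply: eq_bigr => k _.
rewrite /ortho_xjacobi hornerZ exprMn exprVn xnorm_sqr -mulrA.
by rewrite xjacobi_sqr_weight//; ring.
Qed.

End measures_as_functionals.

Theorem theorem1 (R : realType) (alpha beta : R) (k : seed) (N : nat)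
    (s b bw bt : {poly R}) (e1 e2 : bool)
    (halpha : -1 < alpha) (hbeta : -1 < beta)
    (hs : forall x : R, x \in `[-1, 1] -> s.[x] != 0)
    (* a constant factor of b is absorbed into s *)
    (hb : b = s * seed_b0 alpha beta k N)
    (hbw : forall x : R, x \in `]-1, 1[ ->
       bw.[x] = b.[x] * seed_log_derivative alpha beta k N x)
    (hb0 : forall x : R, x \in `]-1, 1[ -> b.[x] != 0)
    (hbt : b = (1 - 'X) ^+ e1 * (1 + 'X) ^+ e2 * bt)
    (hbt0 : forall x : R, x \in `[-1, 1] -> 0 < bt.[x])
    (horth : orthogonal_system (xweight alpha beta e1 e2 bt)
       (fun n x => (xjacobi alpha beta b bw n).[x]))
    (hcompl : complete_system (xweight alpha beta e1 e2 bt)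
       (fun n x => (xjacobi alpha beta b bw n).[x]))
    (hend : forall n, (xjacobi alpha beta b bw n).[1] != 0 /\
                      (xjacobi alpha beta b bw n).[-1] != 0)
    (hbwend : forall a : R, a = 1 \/ a = -1 -> b.[a] = 0 -> bw.[a] != 0)
    (h1 : - (1 / 2) <= alpha + (-1) ^+ e1)
    (h2 : - (1 / 2) <= beta + (-1) ^+ e2) :
  weak_star_cvg (xjacobi_measure alpha beta b bw e1 e2 bt) equilibrium_measure.
Proof.
have ode n : eigenpoly alpha beta (- jacobi_energy alpha beta n)
    (ortho_jacobi alpha beta n).
  by apply: eigenpolyZ; exact: jacobi_eigenpoly.
have y0 n : 0 < jint alpha beta
    (horner (ortho_jacobi alpha beta n * ortho_jacobi alpha beta n)).
  (* A zero norm would make the normalised polynomial zero, by the convention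
     on inverses, and with it the exceptional polynomial, which is nonzero at
     1. *)
  have norm0 : jacobi_norm alpha beta n != 0.
    have [+ _] := hend n; apply: contra_neq => norm0.
    by rewrite /xjacobi /ortho_jacobi norm0 invr0 scale0r derivC !mulr0 subrr horner0.
  have -> : jint alpha beta
      (horner (ortho_jacobi alpha beta n * ortho_jacobi alpha beta n)) =
      jacobi_norm alpha beta n ^- 2 *
      jint alpha beta (horner (jacobi alpha beta n * jacobi alpha beta n)).
    by rewrite /ortho_jacobi -scalerAl -scalerAr scalerA jint_polyZ// -expr2 exprVn.
  have normE : jacobi_norm alpha beta n = Num.sqrt
      (jint alpha beta (horner (jacobi alpha beta n * jacobi alpha beta n))).
    by congr Num.sqrt; apply: eq_Rintegral => x _; rewrite hornerM expr2.
  have j0 : 0 < jint alpha beta (horner (jacobi alpha beta n * jacobi alpha beta n)).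
    by rewrite -sqrtr_gt0 -normE lt_def norm0 sqrtr_ge0.
  by rewrite mulr_gt0// invr_gt0 lt_def sqr_ge0 sqrf_eq0 norm0.
have a1' : -1 < alpha + (-1) ^+ e1 by lra.
have b1' : -1 < beta + (-1) ^+ e2 by lra.
have ae1 : e1 -> 0 < alpha by move=> e; move: h1; rewrite e expr1; lra.
have be2 : e2 -> 0 < beta by move=> e; move: h2; rewrite e expr1; lra.
have tw := bdd_measurable_quotient bw hbt0.
move=> f fc; rewrite equilibrium_measureE//.
have := cesaro (cvg_xint_continuous halpha hbeta ode y0 a1' b1' ae1 be2 tw fc).
rewrite -(cvg_shiftS (fun n => \int[xjacobi_measure _ _ _ _ _ _ _ n]_(x in _) f x)).
apply: cvg_trans; apply: near_eq_cvg; apply: nearW => n.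
rewrite /= xjacobi_measureE//; congr (_ * _).
by rewrite seriesEord.
Qed.
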